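(* Let $G=(V,E)$ be a finite graph and $A,B\subseteq V^2$. For $S\subseteq E$: (i) the number $|\mathrm{Four}_{G,S}(A,B)/\mathrm{cyc}|$ of $(A,B)$-valid cycle classes with solid edge set $S$ is independent of $S$; (ii) the number $|\mathrm{Four}_{G,S}(A,B)/\mathrm{coc}|$ of $(A,B)$-valid cocycle classes with solid edge set $S$ is independent of $S$; (iii) the number $|\mathrm{Four}_{G,S}(A,B)/\mathrm{cc}|$ of $(A,B)$-valid cycle-cocycle classes with solid edge set $S$ is independent of $S$.
   Context: A fourientation $\phi$ of $G$ assigns to each edge one of four configurations: 0-way, 2-way, or one of two 1-way configurations (loops included); its digraph $\vec\phi$ has two opposite arcs per 2-way edge, one arc per 1-way edge in its allowed direction, no arc for 0-way edges. Solid edges are the 0-way and 2-way edges. $\vec G(A,B;\phi)$ is $\vec\phi$ with an arc from $u$ to $v$ added for each $(u,v)\in A$ and each $(u,v)\in B$; $\phi$ is $(A,B)$-valid if in $\vec G(A,B;\phi)$, for all $(u,v)\in A$ there is no directed path from $v$ to $u$, and for all $(u,v)\in B$ there is one. A directed cycle of $\phi$ is a directed cycle of $\vec\phi$; reversing it reverses its 1-way edges and leaves 2-way edges unchanged. A directed cocycle of a digraph is a nonempty arc set $S$ for which there is a partition $V=V_1\cup V_2$ such that $S$ is the set of arcs from $V_1$ to $V_2$ and no arc goes from $V_2$ to $V_1$. An $(A,B)$-cocycle of $\phi$ is a directed cocycle of $\vec G(A,B;\phi)$ containing no arc coming from $A\cup B$; reversing it reverses its 1-way edges. Two fourientations are cycle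 (resp. cocycle, cycle-cocycle) equivalent if one is obtained from the other by repeatedly reversing directed cycles (resp. $(A,B)$-cocycles, directed cycles and/or $(A,B)$-cocycles); these equivalences preserve $(A,B)$-validity and the sets of 0-way and 2-way edges. An $(A,B)$-valid cycle class is a cycle equivalence class of $(A,B)$-valid fourientations which contain no cycle of $G$ made entirely of 2-way edges. An $(A,B)$-valid cocycle class is a cocycle equivalence class of $(A,B)$-valid fourientations which contain no $(A,B)$-cocycle made entirely of 0-way edges, i.e. there is no partition $V=V_1\cup V_2$ such that the set of edges of $G$ joining $V_1$ and $V_2$ is nonempty and consists only of 0-way edges, and no pair of $A\cup B$ has one element in $V_1$ and the other in $V_2$. An $(A,B)$-valid cycle-cocycle class is a cycle-cocycle equivalence class of $(A,B)$-valid fourientations containing neither a cycle made entirely of 2-way edges nor an $(A,B)$-cocycle made entirely of 0-way edges. $\mathrm{Four}_{G,S}(A,B)/\mathrm{cyc}$ (resp. $/\mathrm{coc}$, $/\mathrm{cc}$) denotes the set of such classes whose fourientations have solid edge set $S$. *)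

(* Defs.v *)
From HB Require Import structures.
From mathcomp Require Import all_boot.

Set Implicit Arguments.
Unset Strict Implicit.
Unset Printing Implicit Defensive.

(* Finite graphs, with loops and multiple edges allowed.  The order of the two
   endpoints of an edge is only a reference used to name its two directions. *)
Record graph := Graph {
  vertex : finType;
  edge : finType;
  src : edge -> vertex;
  tgt : edge -> vertex
}.

Section Fourientations.

Variable G : graph.
Local Notation V := (vertex G).
Local Notation E := (edge G).

(* An edge with a direction; a loop also has two of them. *)
Definition arc := (E * bool)%type.
Definition tail (a : arc) : V := if a.2 then src a.1 else tgt a.1.
Definition head (a : arc) : V := if a.2 then tgt a.1 else src a.1.

(* A fourientation is given by the arcs of its digraph: an edge e is 0-way,
   1-way or 2-way when none, exactly one or both of (e, true) and (e, false)
   belong to phi. *)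
Definition fourientation := {set arc}.

Implicit Types (phi psi : fourientation) (A B : {set V * V}).

Definition zero_way phi : {set E} :=
  [set e | ((e, true) \notin phi) && ((e, false) \notin phi)].
Definition two_way phi : {set E} :=
  [set e | ((e, true) \in phi) && ((e, false) \in phi)].
Definition solid phi : {set E} := zero_way phi :|: two_way phi.

(* Exchanging the two arcs of an edge reverses it if it is 1-way, and leaves it
   unchanged if it is 0-way or 2-way. *)
Definition reverse (F : {set E}) phi : fourientation :=
  [set a | if a.1 \in F then (a.1, ~~ a.2) \in phi else a \in phi].

(* The arcs of vec G(A, B; phi) live in a type where those coming from phi,
   from A (inr (true, _)) and from B (inr (false, _)) are distinct. *)
Definition xarc := (arc + bool * (V * V))%type.
Definition xtail (x : xarc) : V :=
  match x with inl a => tail a | inr p => p.2.1 end.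
Definition xhead (x : xarc) : V :=
  match x with inl a => head a | inr p => p.2.2 end.

Definition from_AB (x : xarc) : bool := if x is inr _ then true else false.

Definition vecG A B phi : {set xarc} :=
  [set x : xarc | match x with
                  | inl a => a \in phi
                  | inr (true, p) => p \in A
                  | inr (false, p) => p \in B
                  end].

Definition dipath (D : {set xarc}) : rel V :=
  connect [rel u v | [exists x in D, (xtail x == u) && (xhead x == v)]].

Definition valid A B phi : bool :=
  [forall p in A, ~~ dipath (vecG A B phi) p.2 p.1] &&
  [forall p in B, dipath (vecG A B phi) p.2 p.1].

(* Cyclic sequences of consecutive arcs through distinct vertices. *)
Definition closed_path (c : seq arc) : bool :=
  [&& c != [::], uniq (map tail c) & cycle (fun a b => head a == tail b) c].

Definition directed_cycle phi (c : seq arc) : bool :=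
  closed_path c && all [in phi] c.

(* A cycle of G may not go back and forth along a single edge. *)
Definition graph_cycle (c : seq arc) : bool :=
  closed_path c && uniq (map fst c).

Definition directed_cocycle (D X : {set xarc}) : bool :=
  (X != set0) &&
  [exists V1 : {set V},
     (X == [set x in D | (xtail x \in V1) && (xhead x \notin V1)]) &&
     [forall x in D, ~~ ((xtail x \notin V1) && (xhead x \in V1))]].

Definition AB_cocycle A B phi (X : {set xarc}) : bool :=
  directed_cocycle (vecG A B phi) X && [forall x in X, ~~ from_AB x].

Definition cycle_edges (c : seq arc) : {set E} := [set e in map fst c].
Definition cocycle_edges (X : {set xarc}) : {set E} :=
  [set e | [exists b, inl (e, b) \in X]].

(* Existential quantification over closed paths: as the tails are distinct,
   their length is at most #|V| (see some_closed_pathP). *)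
Definition some_closed_path (P : pred (seq arc)) : bool :=
  [exists k : 'I_#|V|.+1, exists c : k.-tuple arc, closed_path c && P c].

Lemma some_closed_pathP (P : pred (seq arc)) :
  reflect (exists c, closed_path c /\ P c) (some_closed_path P).
Proof.
apply: (iffP existsP) => [[k /existsP[c /andP[cc Pc]]]|[c [cc Pc]]].
  by exists c.
have lec : size c < #|V|.+1.
  have /and3P[_ uc _] := cc.
  by rewrite ltnS -(size_map tail) -(card_uniqP uc) max_card.
by exists (Ordinal lec); apply/existsP; exists (in_tuple c); rewrite /= cc Pc.
Qed.

Definition cyc_step phi psi : bool :=
  some_closed_path
    (fun c => directed_cycle phi c && (psi == reverse (cycle_edges c) phi)).

Definition coc_step A B phi psi : bool :=
  [exists X : {set xarc},
     AB_cocycle A B phi X && (psi == reverse (cocycle_edges X) phi)].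

Definition cyc_equiv : rel fourientation := connect cyc_step.
Definition coc_equiv A B : rel fourientation := connect (coc_step A B).
Definition cc_equiv A B : rel fourientation :=
  connect (fun phi psi => cyc_step phi psi || coc_step A B phi psi).

Definition two_way_cycle phi : bool :=
  some_closed_path
    (fun c => graph_cycle c && all (fun a => a.1 \in two_way phi) c).

Definition cut (V1 : {set V}) : {set E} :=
  [set e | (src e \in V1) != (tgt e \in V1)].

Definition zero_way_cocycle A B phi : bool :=
  [exists V1 : {set V},
     [&& cut V1 != set0, cut V1 \subset zero_way phi &
         [forall p in A :|: B, (p.1 \in V1) == (p.2 \in V1)]]].

(* P ::&: D consists of the classes in P all of whose members are in D. *)
Definition Four_cyc A B (S : {set E}) : {set {set fourientation}} :=
  equivalence_partition cyc_equiv [set: fourientation] ::&: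
    [set phi | [&& valid A B phi, ~~ two_way_cycle phi & solid phi == S]].

Definition Four_coc A B (S : {set E}) : {set {set fourientation}} :=
  equivalence_partition (coc_equiv A B) [set: fourientation] ::&:
    [set phi | [&& valid A B phi, ~~ zero_way_cocycle A B phi &
                   solid phi == S]].

Definition Four_cc A B (S : {set E}) : {set {set fourientation}} :=
  equivalence_partition (cc_equiv A B) [set: fourientation] ::&:
    [set phi | [&& valid A B phi, ~~ two_way_cycle phi,
                   ~~ zero_way_cocycle A B phi & solid phi == S]].

End Fourientations.

(* Main.v *)
Require Import Defs.
From HB Require Import structures.
From mathcomp Require Import all_boot.
From mathcomp Require Import zify.
Import Defs.

(* It suffices to compare the solid sets [S] and [e |: S] for one edge [e].

   Cycle equivalence preserves, for every vertex set crossed by no 2-way edge,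
   the number of arcs leaving its vertices, and this characterizes it; cocycle
   equivalence amounts to the existence of an integer potential whose variation
   along the arcs is the change of direction.  Cycle reversals can be performed
   before cocycle reversals, so the three equivalences are treated together,
   with two booleans [a] and [b] allowing cycles and cocycles respectively.

   Consider, up to equivalence, the fourientations [phi] in which [e] is
   directed from its target [v] to its source [u]; let [phi+], [phi0], [phi2] be
   obtained by reversing, deleting and doubling [e].  Let [P] mean that [a] holds
   and [e] is on a directed cycle of [phi], and [C] that [b] holds and [e] is on
   an (A, B)-cocycle of [phi].
   - A class with [e] 1-way contains some [phi+], unique up to equivalence, or
     consists of fourientations [phi] satisfying neither [P] nor [C].
   - A class with [e] 0-way contains [phi0] for exactly one class of [phi]
     without [C]: reverse cuts until [v] is reachable from [u].
   - A class with [e] 2-way contains [phi2] for exactly one class of [phi]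
     without [P]: reverse paths until [v] is not reachable from [u].
   It remains to check, according to the reachability between [u] and [v], that
     [valid phi+] + [~P, ~C, valid phi] = [~C, valid phi0] + [~P, valid phi2]. *)

(** * Counting classes by representatives *)

Section ClassCounting.

Set Implicit Arguments.
Unset Strict Implicit.

Variables (T : finType) (R : rel T).
Hypothesis Req : equivalence_rel R.
Implicit Types (x y z : T) (D Q X : {set T}).

Definition class_of x : {set T} := [set y | R x y].
Definition nclasses D : nat := #|class_of @: D|.

Let Rxx x : R x x. Proof. by case: (Req x x x). Qed.
Let Rl x y : R x y -> R x =1 R y.
Proof. by move=> xy z; case: (Req x y z) => _; apply. Qed.
Let Rsym x y : R x y -> R y x.
Proof. by move=> xy; rewrite -(Rl xy). Qed.

Lemma class_ofP x y : reflect (class_of x = class_of y) (R x y).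
Proof.
apply: (iffP idP) => [xy|/setP/(_ y)]; last by rewrite !inE Rxx.
by apply/setP => z; rewrite !inE (Rl xy).
Qed.

(** A closed [D] contains every class that it meets, so the families of classes in the theorem can
    be counted from their members. *)
Lemma card_equivalence_partition D :
  (forall x y, R x y -> x \in D -> y \in D) ->
  #|equivalence_partition R [set: T] ::&: D| = nclasses D.
Proof.
move=> Dcl; congr #|pred_of_set _|; apply/setP => C; rewrite !inE.
apply/andP/imsetP => [[/imsetP[x _ ->]] /subsetP sD|[x xD ->]].
  exists x; last by apply/setP => y; rewrite !inE.
  by apply: sD; rewrite !inE Rxx.
split; first by apply/imsetP; exists x => //; apply/setP => y; rewrite !inE.
by apply/subsetP => y; rewrite inE => /Dcl; apply.
Qed.

(** [D1] and [D2] may cover only part of [D]: it is enough that each class of [D] meets exactly one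
    of them. *)
Lemma nclasses_split D D1 D2 :
  D1 \subset D -> D2 \subset D ->
  (forall x, x \in D -> exists2 y, y \in D1 :|: D2 & R x y) ->
  (forall x y, x \in D1 -> y \in D2 -> ~~ R x y) ->
  nclasses D = nclasses D1 + nclasses D2.
Proof.
move=> s1 s2 cov dis.
rewrite /nclasses (_ : class_of @: D = class_of @: D1 :|: class_of @: D2).
  rewrite cardsU [_ :&: _](_ : _ = set0) ?cards0 ?subn0 //.
  apply/setP => C; rewrite !inE; apply/andP => -[/imsetP[x x1 ->]].
  by case/imsetP => y y2 /class_ofP; apply/negP; apply: dis.
rewrite -imsetU; apply/eqP; rewrite eqEsubset; apply/andP; split.
  apply/subsetP => C /imsetP[x /cov[y y12 xy] ->]; apply/imsetP.
  by exists y => //; apply/class_ofP.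
by apply: imsetS; rewrite subUset s1 s2.
Qed.

Definition transversal_of Q X :=
  [/\ X \subset Q, {in X &, forall x y, R x y -> x = y}
    & forall x, x \in Q -> exists2 y, y \in X & R x y].

Lemma transversal_exists Q : exists X, transversal_of Q X.
Proof.
pose r x := odflt x [pick y in Q | R x y].
have rP x : x \in Q -> r x \in Q /\ R x (r x).
  move=> xQ; rewrite /r; case: pickP => [y /andP[]//|/(_ x)].
  by rewrite /= xQ Rxx.
have rR x y : x \in Q -> R x y -> r x = r y.
  move=> xQ xy; rewrite /r (eq_pick (Q := [pred z in Q | R y z])).
    by case: pickP => //= /(_ x); rewrite /= xQ (Rsym xy).
  by move=> z; rewrite /= (Rl xy).
exists (r @: Q); split.
- by apply/subsetP => _ /imsetP[x xQ ->]; case: (rP _ xQ).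
- move=> _ _ /imsetP[x xQ ->] /imsetP[y yQ ->] rxy.
  have [[rxQ xr] [ryQ yr]] := (rP _ xQ, rP _ yQ).
  by rewrite (rR _ _ xQ xr) (rR _ _ rxQ rxy) -(rR _ _ yQ yr).
by move=> x xQ; exists (r x); [apply: imset_f | case: (rP _ xQ)].
Qed.

(** [f] induces a bijection from the classes of [Q] satisfying [p] to those of [D]. As [X] does not
    depend on [f], several counts become sums over the same [X], comparable term by term. *)
Lemma nclasses_transversal Q X D (f : T -> T) (p : pred T) :
  transversal_of Q X ->
  {in Q, forall x, p x -> f x \in D} ->
  {in Q &, forall x y, p x -> p y -> R (f x) (f y) -> R x y} ->
  {in Q &, forall x y, R x y -> p x -> p y /\ R (f x) (f y)} ->
  (forall y, y \in D -> exists x, [/\ x \in Q, p x & R y (f x)]) ->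
  nclasses D = \sum_(x in X) p x.
Proof.
case=> /subsetP sXQ Xinj Xsurj fD finj fR fsurj.
rewrite [RHS](_ : _ = #|[set x in X | p x]|); last first.
  by rewrite -sum1dep_card big_mkcondr; apply: eq_bigr => x _; case: (p x).
rewrite /nclasses (_ : _ @: D = (class_of \o f) @: [set x in X | p x]).
  rewrite card_in_imset // => x y /[!inE] /andP[xX px] /andP[yX py].
  by move/class_ofP/(finj _ _ (sXQ _ xX) (sXQ _ yX) px py)/Xinj; apply.
apply/setP => C; apply/imsetP/imsetP => [[y /fsurj[x [xQ px yx]] ->]|].
  have [z zX xz] := Xsurj _ xQ; have [pz fz] := fR _ _ xQ (sXQ _ zX) xz px.
  exists z; first by rewrite inE zX.
  by apply/class_ofP; rewrite (Rl yx).
by case=> x /[!inE] /andP[xX px] ->; exists (f x) => //; apply: fD => //; apply: sXQ.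
Qed.

End ClassCounting.

(** * Invariants of the reversals *)

Section Invariants.

Set Implicit Arguments.
Unset Strict Implicit.

Variable G : graph.
Local Notation V := (vertex G).
Local Notation E := (edge G).
Implicit Types (phi chi th : fourientation G) (U W : {set V}) (K : {set V * V}).
Implicit Types (e f : E) (x y z u v : V) (p q : V -> nat).

Definition same_degree phi chi := forall f,
  ((f, true) \in phi) + ((f, false) \in phi) =
  ((f, true) \in chi) + ((f, false) \in chi).

Definition out_closed phi W := forall a, a \in phi -> tail a \in W -> head a \in W.

Definition uncut phi U := forall f,
  (f, true) \in phi -> (f, false) \in phi -> (src f \in U) = (tgt f \in U).

Definition outs phi U f : nat :=
  (((f, true) \in phi) && (src f \in U)) + (((f, false) \in phi) && (tgt f \in U)).

Definition out_count phi U : nat := \sum_f outs phi U f.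

(** Reversing a cycle through 2-way edges may change the out-degree of a vertex. An [uncut] set is a
    union of components of the 2-way edges, so the counts amount to out-degrees after contracting
    these edges. *)
Definition cyc_rel phi chi :=
  same_degree phi chi /\ forall U, uncut phi U -> out_count phi U = out_count chi U.

(** [p x] stands for the number of reversed cuts with [x] on their source side. A 1-way edge is
    reversed when [p] drops by one from tail to head, and kept when [p] is equal at both ends; a
    2-way edge forces equality, a 0-way edge nothing. *)
Definition potential K p phi chi :=
  [/\ same_degree phi chi,
      forall r, r \in K -> p r.1 = p r.2
    & forall f, ((f, true) \in phi) || ((f, false) \in phi) ->
        ((f, true) \in phi) + p (tgt f) = ((f, true) \in chi) + p (src f)].

Definition coc_rel K phi chi := exists p, potential K p phi chi.

Lemma same_degree_sym phi chi : same_degree phi chi -> same_degree chi phi.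
Proof. by move=> d f. Qed.

Lemma same_degree_trans th phi chi :
  same_degree phi th -> same_degree th chi -> same_degree phi chi.
Proof. by move=> d d' f; rewrite d. Qed.

Lemma same_degree_uncut phi chi U : same_degree phi chi -> uncut phi U -> uncut chi U.
Proof. by move=> d Uc f ft ff; apply: Uc; move: (d f); rewrite ft ff; lia. Qed.

Lemma out_closed_uncut phi W : out_closed phi W -> uncut phi W.
Proof.
move=> Wc f /Wc /= ft /Wc /= ff; rewrite /tail /head /= in ft ff.
by apply/idP/idP.
Qed.

Lemma cyc_rel_refl phi : cyc_rel phi phi. Proof. by []. Qed.

Lemma cyc_rel_sym phi chi : cyc_rel phi chi -> cyc_rel chi phi.
Proof.
move=> [d N]; split=> [|U Uc]; first exact: same_degree_sym.
by rewrite N //; apply: same_degree_uncut Uc; apply: same_degree_sym.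
Qed.

Lemma cyc_rel_trans th phi chi : cyc_rel phi th -> cyc_rel th chi -> cyc_rel phi chi.
Proof.
move=> [d N] [d' N']; split=> [|U Uc]; first exact: same_degree_trans d'.
by rewrite N // N' //; apply: same_degree_uncut Uc.
Qed.

Lemma coc_rel_refl K phi : coc_rel K phi phi.
Proof. by exists (fun=> 0); split. Qed.

Lemma potential_trans K p q phi th chi :
  potential K p phi th -> potential K q th chi ->
  potential K (fun x => p x + q x) phi chi.
Proof.
move=> [d pK pE] [d' qK qE]; split=> [|r rK|f fE]; first exact: same_degree_trans d'.
  by rewrite pK // qK.
move: (pE f fE) (qE f) (d f); move: fE; case: (_ \in th); case: (_ \in th); lia.
Qed.

Lemma coc_rel_trans K th phi chi :
  coc_rel K phi th -> coc_rel K th chi -> coc_rel K phi chi.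
Proof. by case=> p hp [q hq]; eexists; apply: potential_trans hp hq. Qed.

Lemma coc_rel_sym K phi chi : coc_rel K phi chi -> coc_rel K chi phi.
Proof.
(* The inverse potential is the opposite of [p], shifted by the maximum to stay in [nat]. *)
case=> p [d pK pE]; exists (fun x => \max_y p y - p x); split=> [|r rK|f fE].
- exact: same_degree_sym.
- by rewrite pK.
have := leq_bigmax (F := p) (src f); have := leq_bigmax (F := p) (tgt f).
by move: (pE f) (d f) fE; lia.
Qed.

Lemma potential_arc K p phi chi a :
  potential K p phi chi -> a \in phi -> (p (head a)).+1 = (a \in chi) + p (tail a).
Proof.
case=> d _ pE; case: a => f b af; rewrite /head /tail.
move: (pE f) (d f); case: b af => /= ->; lia.
Qed.

Lemma potential_arc_rev K p phi chi a :
  potential K p phi chi -> a \in chi -> (a \in phi) + p (head a) = (p (tail a)).+1.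
Proof.
case=> d _ pE; case: a => f b af; rewrite /head /tail.
move: (pE f) (d f); case: b af => /= ->; lia.
Qed.

Lemma sum_eq_le (I : finType) (F H : I -> nat) :
  (forall i, F i <= H i) -> \sum_i F i = \sum_i H i -> forall i, F i = H i.
Proof.
move=> FH eqs i; apply/eqP; rewrite eqn_leq FH /= leqNgt; apply/negP => lti.
have: \sum_i F i < \sum_i H i; last by rewrite eqs ltnn.
rewrite (bigD1 i) //= [X in _ < X](bigD1 i) //= -addSn leq_add //.
by apply: leq_sum => j _.
Qed.

(* Among all ways of directing the 1-way edges, one without arc leaving [W]
   minimizes the number of arcs with tail in [W]. *)
Lemma out_closed_agree phi chi W :
  same_degree phi chi -> out_closed phi W -> out_count phi W = out_count chi W ->
  forall a, (tail a \in W) != (head a \in W) -> (a \in phi) = (a \in chi).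
Proof.
move=> d Wc N [f b] cr.
have key g : outs phi W g <= outs chi W g.
  move: (Wc (g, true)) (Wc (g, false)) (d g); rewrite /outs /tail /head /=.
  by lia.
move: (sum_eq_le key N f) (Wc (f, true)) (Wc (f, false)) (d f) cr.
rewrite /outs /tail /head /=.
by case: b => /=; lia.
Qed.

(** An edge between a closed set and its complement belongs to a directed cut, hence to no directed
    cycle. *)
Lemma cyc_rel_agree phi chi W a :
  cyc_rel phi chi -> out_closed phi W -> (tail a \in W) != (head a \in W) ->
  (a \in phi) = (a \in chi).
Proof.
move=> [d N] Wc; apply: (out_closed_agree d Wc); apply: N.
exact: out_closed_uncut.
Qed.

Lemma cyc_rel_out_closed phi chi W :
  cyc_rel phi chi -> out_closed phi W -> out_closed chi W.
Proof.
move=> R Wc a aX ta; apply: contraT => ha.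
have aphi : a \in phi by rewrite (cyc_rel_agree R Wc) // ta (negPf ha).
by rewrite Wc in ha.
Qed.

(** The pairs of [K] act as arcs that are never reversed. The choices used are [set0] for directed
    cycles, [A :|: B] for validity and [AB_sym] for cuts. *)
Definition reach K phi : rel V := connect
  [rel x y | [exists a in phi, (tail a == x) && (head a == y)] || ((x, y) \in K)].

Lemma reach_refl K phi x : reach K phi x x. Proof. exact: connect0. Qed.

Lemma reach_trans K phi : transitive (reach K phi).
Proof. exact: connect_trans. Qed.

Lemma reach_arc K phi a : a \in phi -> reach K phi (tail a) (head a).
Proof.
by move=> aphi; apply/connect1/orP; left; apply/existsP; exists a; rewrite aphi !eqxx.
Qed.

Lemma reach_pair K phi r : r \in K -> reach K phi r.1 r.2.
Proof. by case: r => x y xyK; apply/connect1/orP; right. Qed.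

Lemma reach_ind K phi (P : pred V) x y :
  (forall a, a \in phi -> P (tail a) -> P (head a)) ->
  (forall r, r \in K -> P r.1 -> P r.2) ->
  reach K phi x y -> P x -> P y.
Proof.
move=> Pa PK /connectP[s sp ->]; elim: s x sp => //= z s IHs x /andP[xz sp] Px.
apply: IHs sp _; case/orP: xz => [/exists_inP[a aphi /andP[/eqP ta /eqP <-]]|xzK].
  by apply: Pa; rewrite ?ta.
exact: PK xzK Px.
Qed.

Lemma reach_out_closed K phi x : out_closed phi [set y | reach K phi x y].
Proof.
by move=> a aphi; rewrite !inE => xa; apply: reach_trans xa (reach_arc _ aphi).
Qed.

Lemma reach_sub K K' phi phi' x y :
  (forall a, a \in phi -> reach K' phi' (tail a) (head a)) ->
  (forall r, r \in K -> reach K' phi' r.1 r.2) ->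
  reach K phi x y -> reach K' phi' x y.
Proof.
move=> sa sK /reach_ind -/(_ (reach K' phi' x)); apply; rewrite ?reach_refl //.
  by move=> a /sa ta xa; apply: reach_trans ta.
by move=> r /sK ta xa; apply: reach_trans ta.
Qed.

(** The set reached from [x] in [chi] is closed in [phi] too, so a walk of [phi] starting at [x]
    stays in it. *)
Lemma cyc_rel_reach K phi chi x y :
  cyc_rel phi chi -> reach K phi x y -> reach K chi x y.
Proof.
move=> /cyc_rel_sym R xy.
have Wc := cyc_rel_out_closed R (@reach_out_closed K chi x).
apply: (reach_ind _ _ xy (reach_refl _ _ _)) => [a /Wc|r rK xr].
  by rewrite !inE.
exact: reach_trans xr (reach_pair _ rK).
Qed.

Definition potential_constant p K := forall r, r \in K -> p r.1 = p r.2.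

(** Arcs of [phi] never increase [p]; in the next lemma, arcs of [chi] never decrease it. *)
Lemma potential_reach_le K K' p phi chi x y :
  potential K p phi chi -> potential_constant p K' -> reach K' phi x y -> p y <= p x.
Proof.
move=> pot pK xy; apply: (reach_ind (P := fun z => p z <= p x) _ _ xy) => //.
  by move=> a aphi; have := potential_arc pot aphi; lia.
by move=> r /pK ->.
Qed.

Lemma potential_reach_ge K K' p phi chi x y :
  potential K p phi chi -> potential_constant p K' -> reach K' chi x y -> p x <= p y.
Proof.
move=> pot pK xy; apply: (reach_ind (P := fun z => p x <= p z) _ _ xy) => //.
  by move=> a aphi; have := potential_arc_rev pot aphi; lia.
by move=> r /pK ->.
Qed.

(** Along a closed walk of [phi], [p] is monotone, hence constant, so every arc of the walk is kept.
    The induction carries an implication because the return to [x] from a vertex is deduced from the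
    return from the next one. *)
Lemma potential_reach K K' p phi chi x y :
  potential K p phi chi -> potential_constant p K' ->
  reach K' phi x y -> reach K' phi y x -> reach K' chi x y.
Proof.
move=> pot pK xy yx.
suff: reach K' phi x y && (reach K' phi y x ==> reach K' chi x y).
  by rewrite xy yx.
apply: (reach_ind (P := fun z => reach K' phi x z && (reach K' phi z x ==> reach K' chi x z))
  _ _ xy); last by rewrite !reach_refl.
  move=> a aphi /andP[xt tx]; have th := reach_arc K' aphi.
  rewrite (reach_trans xt th); apply/implyP => hx.
  have /(implyP tx) xt' := reach_trans th hx; apply: reach_trans xt' _.
  apply: reach_arc; have := potential_arc pot aphi.
  have := potential_reach_le pot pK (reach_trans hx xt).
  by case: (a \in chi) => //; lia.
move=> r rK /andP[xt tx]; have th := reach_pair phi rK.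
rewrite (reach_trans xt th); apply/implyP => hx.
have /(implyP tx) xt' := reach_trans th hx; apply: reach_trans xt' _.
exact: reach_pair.
Qed.

End Invariants.

(** * Reversing directed cycles *)

Section Reversals.

Set Implicit Arguments.
Unset Strict Implicit.

Variable G : graph.
Local Notation V := (vertex G).
Local Notation E := (edge G).
Implicit Types (phi chi th D : fourientation G) (U W : {set V}) (K : {set V * V}).
Implicit Types (e f : E) (x y z u v : V) (p q : V -> nat) (c : seq (arc G)).

(* The potential keeps the edges it reverses apart from those on directed
   cycles, so the cycle reversals can be performed first. *)
Lemma potential_cyc_rel K p th chi chi' :
  potential K p th chi -> cyc_rel chi chi' ->
  exists2 th', cyc_rel th th' & potential K p th' chi'.
Proof.
move=> pot R; have [d pK pE] := pot; have [d' N] := R.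
(* Arcs of [chi] never decrease [p], so its upper level sets are closed in [chi]; one of them
   separates the ends of any edge along which [p] varies. *)
have agree a : p (tail a) != p (head a) -> (a \in chi) = (a \in chi').
  move=> pa; apply: (cyc_rel_agree (W := [set z | maxn (p (tail a)) (p (head a)) <= p z]) R).
    by move=> a' aX; rewrite !inE; have := potential_arc_rev pot aX; lia.
  by rewrite !inE; lia.
(* Where [p] is equal at both ends of an edge, [th] and [chi] agree, so the changes from [chi] to
   [chi'] can be copied onto [th]. *)
pose th' : fourientation G :=
  [set a | if p (tail a) == p (head a) then a \in chi' else a \in th].
have inth' f (b : bool) : ((f, b) \in th') =
  if p (src f) == p (tgt f) then (f, b) \in chi' else (f, b) \in th.
  by rewrite inE; case: b; rewrite /tail /head //= eq_sym.
have dd : same_degree th th'.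
  by move=> f; rewrite !inth'; case: eqP => // _; rewrite d d'.
exists th'.
  split=> // U Uc; have Uc' := same_degree_uncut d Uc.
  have: out_count th' U + out_count chi U = out_count th U + out_count chi' U.
    rewrite /out_count -!big_split; apply: eq_bigr => f _ /=; rewrite /outs !inth'.
    case: eqP => pf; last by rewrite !agree //; apply/eqP => // /esym.
    by move: (pE f) (d f); rewrite pf; lia.
  by rewrite (N U Uc'); lia.
split=> // f; first by rewrite -dd d d'.
rewrite !inth'; case: eqP => [-> //|pf] fE.
by rewrite -agree; [apply: pE | apply/eqP].
Qed.

Lemma in_cycle_edges c f :
  (f \in cycle_edges c) = ((f, true) \in c) || ((f, false) \in c).
Proof.
rewrite inE; apply/mapP/orP => [[[g []] gc /= ->]|[] fc]; auto.
  by exists (f, true).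
by exists (f, false).
Qed.

Lemma in_reverse (F : {set E}) phi f (b : bool) :
  ((f, b) \in reverse F phi) = if f \in F then (f, ~~ b) \in phi else (f, b) \in phi.
Proof. by rewrite inE. Qed.

Lemma count_arcs (P : pred (arc G)) c : uniq c ->
  count P c = \sum_f ((((f, true) \in c) && P (f, true)) +
                      (((f, false) \in c) && P (f, false))).
Proof.
move=> uc; rewrite -sum1_count big_mkcond big_uniq //= big_mkcond /=.
rewrite (eq_bigr (fun a : arc G => ((a.1, a.2) \in c) && P (a.1, a.2) : nat)).
  rewrite -(pair_bigA _ (fun f b => ((f, b) \in c) && P (f, b) : nat)) /=.
  by apply: eq_bigr => f _; rewrite big_bool.
by case=> f b _ /=; case: ((f, b) \in c) => //; case: (P _).
Qed.

Lemma closed_path_heads c : closed_path c -> map (@head G) c = rot 1 (map (@tail G) c).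
Proof.
case: c => [//|a c] /and3P[_ _] /=; rewrite rot1_cons.
elim: c {1 3}a => [|b c IHc] a' /=; first by rewrite andbT => /eqP ->.
by case/andP=> /eqP -> /IHc ->.
Qed.

(** A closed path has as many tails as heads in [U], and reversal exchanges them. A 2-way edge
    contributes equally in both directions, its ends being on the same side of [U]. *)
Lemma cyc_rel_reverse phi c :
  closed_path c -> all [in phi] c -> cyc_rel phi (reverse (cycle_edges c) phi).
Proof.
move=> cc /allP cphi; split=> [f|U Uc]; rewrite /out_count.
  by rewrite !in_reverse; case: ifP => // _; rewrite addnC.
have uc : uniq c by case/and3P: cc => _ /map_uniq.
have eqc : count (fun a => tail a \in U) c = count (fun a => head a \in U) c.
  rewrite -(count_map (@tail G) [in U]) -(count_map (@head G) [in U]).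
  by rewrite closed_path_heads //; apply/permP; rewrite perm_sym perm_rot.
have: \sum_f outs phi U f + count (fun a => head a \in U) c =
      \sum_f outs (reverse (cycle_edges c) phi) U f + count (fun a => tail a \in U) c.
  rewrite !count_arcs // -!big_split; apply: eq_bigr => f _ /=.
  rewrite /outs !in_reverse in_cycle_edges /tail /head /=.
  move: (Uc f) (cphi (f, true)) (cphi (f, false)) => /=.
  case: ((f, true) \in c) => /=; case: ((f, false) \in c) => /=; lia.
by rewrite eqc; lia.
Qed.

Lemma closed_path_through D a :
  a \in D -> reach set0 D (head a) (tail a) ->
  exists2 c, closed_path c & (a \in c) && all [in D] c.
Proof.
move=> aD /connectP[s0 /shortenP[s sp us _] st].
have [l [lt lh lD lp]] : exists l, [/\ map (@tail G) l = belast (head a) s,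
    map (@head G) l = s, all [in D] l & path (fun a b => head a == tail b) a l].
  move: (head a) {st us} sp {-2}a (erefl (head a)) => x.
  elim: s x => [|y s IHs] x /= sp a' ax; first by exists [::].
  have /andP[/orP[/existsP[b /and3P[bD /eqP tb /eqP hb]]|xy] sp'] := sp; last by rewrite inE in xy.
  have [l [lt lh lD lp]] := IHs _ sp' b hb.
  by exists (b :: l); rewrite /= lt lh bD lp tb hb ax eqxx.
exists (a :: l); last by rewrite mem_head /= aD.
apply/and3P; split=> //=.
  by rewrite lt st -rcons_uniq -lastI.
by rewrite rcons_path lp -last_map lh st eqxx.
Qed.

Lemma cyc_stepP phi chi : reflect
  (exists c, [/\ closed_path c, all [in phi] c & chi = reverse (cycle_edges c) phi])
  (cyc_step phi chi).
Proof.
apply: (iffP (some_closed_pathP _)) => [[c [cc /andP[/andP[_ cphi] /eqP ->]]]|].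
  by exists c.
by case=> c [cc cphi ->]; exists c; rewrite /directed_cycle cc cphi eqxx.
Qed.

(** Each arc of [phi] missing from [chi] lies on a directed cycle whose other arcs are missing from
    [chi] or 2-way. Reversing this cycle brings [phi] closer to [chi]. *)
Lemma cyc_rel_connect phi chi : cyc_rel phi chi -> connect (@cyc_step G) phi chi.
Proof.
move: {2}_.+1 (ltnSn #|phi :\: chi|) => n.
elim: n phi => // n IHn phi; rewrite ltnS => len R; have [d N] := R.
have [sub|] := boolP (phi \subset chi).
  suff -> : phi = chi by exact: connect0.
  have sub' f (b : bool) : (f, b) \in phi -> (f, b) \in chi by apply: (subsetP sub).
  have eqb f (b : bool) : ((f, b) \in phi) = ((f, b) \in chi).
    by move: (d f) (sub' f true) (sub' f false); case: b; lia.
  by apply/setP => -[f b]; apply: eqb.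
case/subsetPn => -[f0 b0] aphi aX.
pose D : fourientation G := [set a in phi | (a \notin chi) || ((a.1, ~~ a.2) \in phi)].
have aD : (f0, b0) \in D by rewrite inE aphi aX.
have back : reach set0 D (head (f0, b0)) (tail (f0, b0)).
  (* Otherwise, no 2-way edge crosses the set [W] reached from the head, and every arc of [phi]
     leaving [W] is kept in [chi]. As the chosen edge enters [W] in [phi] and leaves it in [chi],
     the counts for [W] differ. *)
  apply: contraT => nback; pose W := [set y | reach set0 D (head (f0, b0)) y].
  have Wc : out_closed D W by apply: reach_out_closed.
  have WD f (b : bool) : (f, b) \in phi -> ((f, b) \notin chi) || ((f, ~~ b) \in phi) ->
      tail (f, b) \in W -> head (f, b) \in W.
    by move=> fphi fX; apply: Wc; rewrite inE fphi.
  have Wu : uncut phi W.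
    by move=> f; move: (WD f true) (WD f false); rewrite /tail /head /=; lia.
  have key f : outs phi W f <= outs chi W f.
    move: (WD f true) (WD f false) (d f) (Wu f); rewrite /outs /tail /head /=; lia.
  have := sum_eq_le key (N W Wu) f0; have := d f0.
  have : head (f0, b0) \in W by rewrite inE reach_refl.
  have : tail (f0, b0) \notin W by rewrite inE.
  by rewrite /outs /tail /head /=; case: (b0) aphi aX => /=; lia.
have [c cc /andP[ac /allP cD]] := closed_path_through aD back.
have cphi : all [in phi] c by apply/allP => a /cD; rewrite !inE => /andP[].
have R' := cyc_rel_reverse cc cphi.
apply: connect_trans (connect1 (_ : cyc_step phi (reverse (cycle_edges c) phi))) _.
  by apply/cyc_stepP; exists c.
apply: IHn (cyc_rel_trans (cyc_rel_sym R') R).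
apply: leq_trans len; apply: proper_card; apply/properP; split.
  apply/subsetP => -[f b]; rewrite !in_setD in_reverse => /andP[nX].
  rewrite nX /=; case: ifP => // fc fphi; apply: contraT => nphi.
  have nc : (f, b) \notin c by apply: contra nphi => /(allP cphi).
  have /cD : (f, ~~ b) \in c.
    by move: fc; rewrite in_cycle_edges; case: (b) nc => /negPf-> //=; rewrite orbF.
  rewrite inE fphi /= negbK (negPf nphi) orbF => nX'.
  by move: (d f); case: (b) fphi nX nX' nphi => /= -> /negPf-> /negPf-> /negPf->.
exists (f0, b0); first by rewrite in_setD aphi aX.
rewrite in_setD in_reverse aX /= ifT; first move: (d f0); last first.
  by rewrite in_cycle_edges; case: (b0) ac => ->; rewrite ?orbT.
case: (b0) aphi aX => /= -> /negPf->; lia.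
Qed.

End Reversals.

(** * Reversing cocycles *)

Section Equivalences.

Set Implicit Arguments.
Unset Strict Implicit.

Variable G : graph.
Local Notation V := (vertex G).
Local Notation E := (edge G).
Variables A B : {set V * V}.
Local Notation AB := (A :|: B).
Implicit Types (phi chi th : fourientation G) (U W : {set V}).
Implicit Types (e f : E) (x y z u v : V) (p q : V -> nat).

(** Cocycles are handled through their source sides, which may also be left by no arc at all;
    [reverse_cut] then changes nothing. *)
Definition source_side phi W :=
  (forall a, a \in phi -> head a \in W -> tail a \in W) /\
  (forall r, r \in AB -> (r.1 \in W) = (r.2 \in W)).

Definition arcs_leaving phi W : {set xarc G} :=
  [set x in vecG A B phi | (xtail x \in W) && (xhead x \notin W)].

Definition reverse_cut phi W := reverse (cocycle_edges (arcs_leaving phi W)) phi.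

Lemma in_cocycle_edges phi W f : (f \in cocycle_edges (arcs_leaving phi W)) =
  [|| [&& (f, true) \in phi, src f \in W & tgt f \notin W]
    | [&& (f, false) \in phi, tgt f \in W & src f \notin W]].
Proof.
rewrite inE; apply/existsP/orP => [[[]]|[] fW]; rewrite ?inE.
- by left.
- by right.
- by exists true; rewrite !inE.
by exists false; rewrite !inE.
Qed.

Lemma potential_reverse_cut phi W : source_side phi W ->
  potential AB (fun x => x \in W) phi (reverse_cut phi W).
Proof.
case=> Wphi WK; split=> [f|r /WK -> //|f].
  by rewrite !in_reverse; case: ifP => // _; rewrite addnC.
rewrite in_reverse in_cocycle_edges; move: (Wphi (f, true)) (Wphi (f, false)).
rewrite /tail /head /=; case: (src f \in W); case: (tgt f \in W);
  case: ((f, true) \in phi); case: ((f, false) \in phi) => //= h1 h2 _;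
  by [have := h1 isT isT | have := h2 isT isT].
Qed.

Lemma coc_stepP phi chi : coc_step A B phi chi ->
  exists2 W, source_side phi W & chi = reverse_cut phi W.
Proof.
case/existsP => X /andP[/andP[/andP[_ /existsP[W /andP[/eqP XE /forall_inP noin]]]]].
move=> /forall_inP noAB /eqP ->; exists W; last by rewrite /reverse_cut /arcs_leaving -XE.
split=> [a aphi ha|r rAB].
  have := noin (inl a); rewrite inE => /(_ aphi) /=; by rewrite ha andbT negbK.
(* A pair separated by [W] would be an arc of [vecG] that enters [W] or belongs to the cocycle; both
   are excluded. *)
have [b rb] : exists b, inr (b, r) \in vecG A B phi.
  by case/setUP: rAB => rK; [exists true | exists false]; rewrite inE.
have := noin _ rb; have := noAB (inr (b, r)); rewrite XE in_set rb /=.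
by case: (r.1 \in W); case: (r.2 \in W) => //= /(_ isT).
Qed.

Lemma reverse_cut_step phi W : source_side phi W ->
  reverse_cut phi W = phi \/ coc_step A B phi (reverse_cut phi W).
Proof.
case=> Wphi WK; have [X0|XN0] := eqVneq (arcs_leaving phi W) set0.
  left; rewrite /reverse_cut X0; apply/setP => -[f b]; rewrite in_reverse ifN //.
  by rewrite inE; apply/existsP => -[b']; rewrite inE.
right; apply/existsP; exists (arcs_leaving phi W); rewrite eqxx andbT.
rewrite /AB_cocycle /directed_cocycle XN0 /=; apply/andP; split.
  apply/existsP; exists W; rewrite eqxx; apply/forall_inP => -[a|[b r]] xphi /=.
    by rewrite inE in xphi; apply/negP => /andP[/negP ta /(Wphi _ xphi)].
  suff /WK -> : r \in AB by rewrite andNb.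
  by move: xphi; rewrite !inE; case: b => ->; rewrite ?orbT.
apply/forall_inP => -[//|[b r]]; rewrite in_set => /andP[xphi] /=.
suff /WK -> : r \in AB by rewrite andbN.
by move: xphi; rewrite !inE; case: b => ->; rewrite ?orbT.
Qed.

Lemma reverse_cut_connect phi W : source_side phi W ->
  connect (coc_step A B) phi (reverse_cut phi W).
Proof. by move/reverse_cut_step => [->|/connect1]. Qed.

(** The set where [p] is maximal is a source side. Reversing its cut and lowering [p] by one on it
    decreases the sum of [p], until [p] vanishes and [phi = chi]. *)
Lemma potential_connect p phi chi :
  potential AB p phi chi -> connect (coc_step A B) phi chi.
Proof.
move: {2}_.+1 (ltnSn (\sum_x p x)) => n.
elim: n p phi => // n IHn p phi; rewrite ltnS => len pot; have [d pK pE] := pot.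
have [/existsP[x0 px0]|/existsPn p0] := boolP [exists x, 0 < p x]; last first.
  suff -> : phi = chi by exact: connect0.
  have eqb f (b : bool) : ((f, b) \in phi) = ((f, b) \in chi).
    by move: (d f) (pE f) (p0 (src f)) (p0 (tgt f)); case: b; lia.
  by apply/setP => -[f b]; apply: eqb.
pose m := \max_x p x; pose W := [set x | p x == m].
have pm x : p x <= m by apply: (leq_bigmax x).
have side : source_side phi W.
  split=> [a aphi|r /pK pr]; rewrite !inE; last by rewrite pr.
  by have := potential_arc pot aphi; have := pm (tail a); lia.
apply: connect_trans (reverse_cut_connect side) _.
have [d' _ pE'] := potential_reverse_cut side.
apply: (IHn (fun x => p x - (x \in W))); last split.
- apply: leq_trans len; have [x1 px1] : exists x1, p x1 = m.
    by have [|x1 m1] := @eq_bigmax V p; [apply/card_gt0P; exists x0 | exists x1].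
  rewrite (bigD1 x1) //= [X in _ < X](bigD1 x1) //= -addSn.
  apply: leq_add; last by apply: leq_sum => x _; apply: leq_subr.
  by rewrite inE px1 eqxx subn1 prednK //; have := pm x0; lia.
- exact: same_degree_trans (same_degree_sym d') d.
- by move=> r rK; rewrite pK //; case: side => _ ->.
move=> f fE; have fphi : ((f, true) \in phi) || ((f, false) \in phi).
  by move: (d' f) fE; lia.
move: (pE f fphi) (pE' f fphi) (pm x0) px0; rewrite !inE; lia.
Qed.

Variables a b : bool.

Definition step phi chi := (a && cyc_step phi chi) || (b && coc_step A B phi chi).
Definition rev_equiv := connect step.

(** Normal form: a cycle stage, then a cocycle stage, a forbidden stage being an equality. By
    induction on the reversals, a last cycle reversal is moved to the first stage by
    [potential_cyc_rel], and a last cut reversal is added to the potential. *)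
Lemma rev_equivP phi chi : rev_equiv phi chi <-> exists2 th,
  if a then cyc_rel phi th else phi = th & if b then coc_rel AB th chi else th = chi.
Proof.
split.
  have r0 : exists2 th, if a then cyc_rel phi th else phi = th
      & if b then coc_rel AB th phi else th = phi.
    exists phi; first by case: (a) => //; apply: cyc_rel_refl.
    by case: (b) => //; apply: coc_rel_refl.
  case/connectP=> s; elim/last_ind: s chi => [|s z IHs] chi; first by move=> _ ->.
  rewrite rcons_path last_rcons => /andP[sp st] ->.
  have [th R1 R2] := IHs _ sp erefl.
  case/orP: st => /andP[fl].
    case/cyc_stepP => c [cc cphi zE]; rewrite fl in R1 *.
    have := cyc_rel_reverse cc cphi; rewrite -zE => Rz.
    case: (b) R2 => [[p pot]|thE]; last first.
      by exists z => //; apply: cyc_rel_trans R1 _; rewrite thE.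
    have [th' R3 pot'] := potential_cyc_rel pot Rz.
    by exists th'; [apply: cyc_rel_trans R3 | exists p].
  case/coc_stepP => W side zE; rewrite fl in R2 *; exists th => //.
  by apply: coc_rel_trans R2 _; eexists; rewrite zE; apply: potential_reverse_cut.
case=> th R1 R2; apply: (connect_trans (y := th)).
  rewrite /step; case: (a) R1 => [/cyc_rel_connect|->]; last exact: connect0.
  by apply: connect_sub => x y xy; apply/connect1; rewrite xy.
rewrite /step; case: (b) R2 => [[p /potential_connect]|->]; last exact: connect0.
by apply: connect_sub => x y xy; apply/connect1; rewrite xy orbT.
Qed.

(** Both stages are symmetric; read backwards they come in the wrong order, which
    [potential_cyc_rel] repairs. *)
Lemma rev_equiv_sym : symmetric rev_equiv.
Proof.
suff sub phi chi : rev_equiv phi chi -> rev_equiv chi phi.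
  by move=> phi chi; apply/idP/idP => /sub.
case/rev_equivP=> th R1 R2; apply/rev_equivP.
have R1' : if a then cyc_rel th phi else th = phi.
  by case: (a) R1 => // /cyc_rel_sym.
case: (b) R2 => [/coc_rel_sym[p pot]|<-]; last by exists phi.
case: (a) R1' => [R|<-]; last by exists chi => //; exists p.
have [th' R3 pot'] := potential_cyc_rel pot R.
by exists th' => //; exists p.
Qed.

Lemma rev_equiv_equivalence : equivalence_rel rev_equiv.
Proof.
have tr : transitive rev_equiv by exact: connect_trans.
move=> x y z; split; first exact: connect0.
by move=> xy; apply/idP/idP => [|yz]; [apply: tr; rewrite rev_equiv_sym | apply: tr yz].
Qed.

End Equivalences.

(** * Changing the state of an edge *)

Section EdgeStates.

Set Implicit Arguments.
Unset Strict Implicit.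

Variable G : graph.
Local Notation V := (vertex G).
Local Notation E := (edge G).
Variables (A B : {set V * V}) (a b : bool) (e : E).
Local Notation AB := (A :|: B).
Local Notation requiv := (rev_equiv A B a b).
Implicit Types (phi chi th : fourientation G) (U W : {set V}) (K : {set V * V}).
Implicit Types (f : E) (x y z : V) (p : V -> nat) (s : pred bool) (d : bool).

(** The states of [e] are encoded by [pred0] for 0-way, [pred1 d] for 1-way in direction [d], and
    [predT] for 2-way. *)
Definition set_edge s phi : fourientation G :=
  [set r | if r.1 == e then s r.2 else r \in phi].

Definition one_way d phi := ((e, d) \in phi) && ((e, ~~ d) \notin phi).

Lemma in_set_edge s phi f d :
  ((f, d) \in set_edge s phi) = if f == e then s d else (f, d) \in phi.
Proof. by rewrite inE. Qed.

Lemma set_edgeK s s' phi : set_edge s (set_edge s' phi) = set_edge s phi.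
Proof. by apply/setP => -[f d]; rewrite !in_set_edge; case: eqP. Qed.

Lemma set_edge_id s phi : (forall d, s d = ((e, d) \in phi)) -> set_edge s phi = phi.
Proof.
by move=> sE; apply/setP => -[f d]; rewrite in_set_edge; case: eqP => // ->.
Qed.

Lemma one_wayP d phi : reflect (set_edge (pred1 d) phi = phi) (one_way d phi).
Proof.
apply: (iffP andP) => [[ed end_]|<-].
  apply: set_edge_id => d' /=.
  by case: d d' ed end_ => -[] /= => [->|_ /negPf->|_ /negPf->|->].
by rewrite !in_set_edge eqxx /= eqxx; case: d.
Qed.

Lemma one_way_set_edge d phi : one_way d (set_edge (pred1 d) phi).
Proof. by apply/one_wayP; rewrite set_edgeK. Qed.

Lemma one_way_in d phi d' : one_way d phi -> ((e, d') \in phi) = (d' == d).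
Proof. by move/one_wayP <-; rewrite in_set_edge eqxx. Qed.

Lemma out_count_set_edge s phi U : out_count (set_edge s phi) U + outs phi U e =
  out_count phi U + ((s true && (src e \in U)) + (s false && (tgt e \in U))).
Proof.
rewrite /out_count (bigD1 e) //= [X in _ = X + _](bigD1 e) //=.
rewrite [\sum_(i | i != e) outs (set_edge _ _) _ _](eq_bigr (outs phi U)).
  by rewrite {1}/outs !in_set_edge eqxx; lia.
by move=> f fe; rewrite /outs !in_set_edge (negPf fe).
Qed.

Lemma outs_one_way d phi U : one_way d phi -> outs phi U e = (tail (e, d) \in U).
Proof. by move=> ow; rewrite /outs !(one_way_in _ ow); case: d {ow}; rewrite ?addn0. Qed.

Lemma same_degree_set_edge s phi chi :
  same_degree phi chi -> same_degree (set_edge s phi) (set_edge s chi).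
Proof. by move=> deg f; rewrite !in_set_edge; case: eqP. Qed.

(** When [e] is doubled, its two directions may differ: an [uncut] set then has both ends of [e] on
    the same side. *)
Lemma cyc_rel_set_edge s d d' phi chi : one_way d phi -> one_way d' chi ->
  (d == d') || s true && s false ->
  cyc_rel phi chi -> cyc_rel (set_edge s phi) (set_edge s chi).
Proof.
move=> ow ow' dd [deg N]; split=> [|U Uc]; first exact: same_degree_set_edge.
have Uphi : uncut phi U.
  move=> f; case: (eqVneq f e) => [->|fe ft ff].
    by rewrite !(one_way_in _ ow); case: (d).
  by apply: Uc; rewrite in_set_edge (negPf fe).
have := out_count_set_edge s phi U; have := out_count_set_edge s chi U.
rewrite (N U Uphi) (outs_one_way _ ow) (outs_one_way _ ow').
case/orP: dd => [/eqP ->|/andP[st sf]]; first lia.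
have := Uc e; rewrite !in_set_edge eqxx => /(_ st sf) eqU.
by rewrite /tail; case: (d); case: (d') => /=; rewrite eqU; lia.
Qed.

Lemma cyc_rel_insert s phi chi :
  cyc_rel (set_edge pred0 phi) (set_edge pred0 chi) ->
  cyc_rel (set_edge s phi) (set_edge s chi).
Proof.
move=> [deg N]; split=> [|U Uc].
  by rewrite -(set_edgeK s pred0 phi) -(set_edgeK s pred0 chi); apply: same_degree_set_edge.
have Uphi : uncut (set_edge pred0 phi) U.
  by move=> f; have := Uc f; rewrite !in_set_edge; case: eqP.
have := out_count_set_edge s (set_edge pred0 phi) U.
have := out_count_set_edge s (set_edge pred0 chi) U.
by rewrite !set_edgeK /outs !in_set_edge eqxx N //; lia.
Qed.

Lemma potential_set_edge s K p phi chi : potential K p phi chi ->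
  p (src e) = p (tgt e) -> potential K p (set_edge s phi) (set_edge s chi).
Proof.
move=> [deg pK pE] pe; split=> [||f]; [exact: same_degree_set_edge|by []|].
by rewrite !in_set_edge; case: eqP => [->|_ /pE //]; rewrite pe.
Qed.

Lemma potential_delete K p phi chi : potential K p phi chi ->
  potential K p (set_edge pred0 phi) (set_edge pred0 chi).
Proof.
move=> [deg pK pE]; split=> [||f]; [exact: same_degree_set_edge|by []|].
by rewrite !in_set_edge; case: eqP => [->|_ /pE //].
Qed.

Lemma potential_one_way K p d phi chi : one_way d phi -> one_way d chi ->
  potential K p phi chi -> p (src e) = p (tgt e).
Proof.
move=> ow ow' pot; have := potential_arc (a := (e, d)) pot.
rewrite !(one_way_in _ ow) (one_way_in _ ow') eqxx /tail /head => /(_ isT).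
by case: (d) => /=; lia.
Qed.

Lemma same_degree_one_way d phi chi :
  same_degree phi chi -> one_way d phi -> one_way true chi || one_way false chi.
Proof.
move=> deg ow; have := deg e; rewrite !(one_way_in _ ow) /one_way /=.
by case: d {ow}; case: ((e, true) \in chi); case: ((e, false) \in chi).
Qed.

(** An edge is not reversed in both stages: if the cocycle stage reverses it, [p] varies along it,
    so a level set of [p] closed in [th] separates its ends and the cycle stage cannot have changed
    it. *)
Lemma one_way_mid K p d phi th chi : cyc_rel phi th -> potential K p th chi ->
  one_way d phi -> one_way d chi -> one_way d th.
Proof.
move=> R pot ow ow'; have [deg _] := R.
case: (boolP (one_way d th)) => // nd.
have {nd}owt : one_way (~~ d) th.
  by move: nd (same_degree_one_way deg ow); case: (d) => /negPf -> /=; rewrite ?orbF.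
pose W := [set z | p z <= p (head (e, ~~ d))].
have Wc : out_closed th W.
  by move=> r rth; rewrite !inE; have := potential_arc pot rth; lia.
have pe : p (tail (e, ~~ d)) = (p (head (e, ~~ d))).+1.
  have := potential_arc (a := (e, ~~ d)) pot.
  by rewrite (one_way_in _ owt) (one_way_in _ ow') eqxx; case: (d) => /(_ isT).
have := cyc_rel_agree (a := (e, ~~ d)) (cyc_rel_sym R) Wc; move: Wc => _.
rewrite !inE pe leqnn ltnn (one_way_in _ owt) (one_way_in _ ow) eqxx.
by case: (d) => /(_ isT).
Qed.

Lemma equiv_set_edge s d phi chi : one_way d phi -> one_way d chi ->
  requiv phi chi -> requiv (set_edge s phi) (set_edge s chi).
Proof.
move=> ow ow' /rev_equivP[th R1 R2].
have owt : one_way d th.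
  case: (a) R1 => [R1|<- //]; case: (b) R2 => [[p pot]|-> //].
  exact: one_way_mid pot ow ow'.
apply/rev_equivP; exists (set_edge s th).
  case: (a) R1 => [R1|-> //]; apply: cyc_rel_set_edge ow owt _ R1.
  by rewrite eqxx.
case: (b) R2 => [[p pot]|-> //]; exists p; apply: potential_set_edge => //.
exact: potential_one_way owt ow' pot.
Qed.

Lemma equiv_same_degree phi chi : requiv phi chi -> same_degree phi chi.
Proof.
case/rev_equivP=> th R1 R2; apply: (@same_degree_trans _ th).
  by case: (a) R1 => [[]|-> //].
by case: (b) R2 => [[p []]|-> //].
Qed.

Definition AB_sym := AB :|: [set (r.2, r.1) | r in AB].

Lemma potential_AB_sym p phi chi : potential AB p phi chi -> potential_constant p AB_sym.
Proof. by case=> _ pK _ r /setUP[/pK //|/imsetP[r' /pK pr ->]]. Qed.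

(** Cut reversals do not preserve reachability in one direction; mutual reachability survives both
    stages. *)
Lemma equiv_reach K phi chi x y : K \subset AB_sym -> requiv phi chi ->
  reach K phi x y -> reach K phi y x -> reach K chi x y.
Proof.
move=> /subsetP sK /rev_equivP[th R1 R2] xy yx.
have {xy yx}[xy yx] : reach K th x y /\ reach K th y x.
  by case: (a) R1 => [R1|<-]; split=> //; apply: cyc_rel_reach R1 _.
case: (b) R2 => [[p pot]|<- //]; apply: (potential_reach pot) xy yx.
by move=> r /sK; apply: potential_AB_sym pot _.
Qed.

Lemma valid_reach phi : valid A B phi =
  [forall r in A, ~~ reach AB phi r.2 r.1] && [forall r in B, reach AB phi r.2 r.1].
Proof.
have dE x y : dipath (vecG A B phi) x y = reach AB phi x y.
  apply: eq_connect => {x y} x y /=; apply/exists_inP/orP.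
    case=> -[r|[k r]]; rewrite inE => rphi /andP[/eqP <- /eqP <-]; [left|right].
      by apply/existsP; exists r; rewrite rphi !eqxx.
    by case: k rphi; rewrite !inE => rK; rewrite -surjective_pairing rK ?orbT.
  case=> [/existsP[r /and3P[rphi tr hr]]|/setUP[]rK].
  - by exists (inl r); rewrite ?inE ?tr.
  - by exists (inr (true, (x, y))); rewrite ?inE ?eqxx.
  by exists (inr (false, (x, y))); rewrite ?inE ?eqxx.
by rewrite /valid; congr (_ && _); apply: eq_forallb => r; rewrite dE.
Qed.

Lemma valid_eq phi chi :
  (forall r, r \in AB -> reach AB phi r.2 r.1 = reach AB chi r.2 r.1) ->
  valid A B phi = valid A B chi.
Proof.
move=> eqr; rewrite !valid_reach; congr (_ && _); apply: eq_forallb => r.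
  by case: (boolP (r \in A)) => //= rA; rewrite eqr // inE rA.
by case: (boolP (r \in B)) => //= rB; rewrite eqr // inE rB orbT.
Qed.

(** A pair [r] already leads from [r.1] to [r.2], so a walk back from [r.2] to [r.1] makes
    reachability mutual, and [equiv_reach] applies. *)
Lemma equiv_valid phi chi : requiv phi chi -> valid A B phi = valid A B chi.
Proof.
have sub phi' chi' r : requiv phi' chi' -> r \in AB ->
    reach AB phi' r.2 r.1 -> reach AB chi' r.2 r.1.
  move=> eqv rAB rr; apply: equiv_reach eqv rr _; first exact: subsetUl.
  exact: reach_pair.
move=> eqv; apply: valid_eq => r rAB; apply/idP/idP; apply: sub => //.
by rewrite rev_equiv_sym.
Qed.

End EdgeStates.

(** * Validity of the four states *)

Section InsertArc.

Set Implicit Arguments.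
Unset Strict Implicit.

Variable G : graph.
Local Notation V := (vertex G).
Variables (A B : {set V * V}).
Local Notation AB := (A :|: B).
Implicit Types (phi chi : fourientation G) (K : {set V * V}) (x y : V) (r : arc G).

Lemma reach_sub_arcs K phi chi x y : phi \subset chi -> reach K phi x y -> reach K chi x y.
Proof.
move=> /subsetP sub; apply: reach_sub => [r /sub|r]; [exact: reach_arc|exact: reach_pair].
Qed.

Lemma reach_sub_pairs K K' phi x y : K \subset K' -> reach K phi x y -> reach K' phi x y.
Proof.
move=> /subsetP sub; apply: reach_sub => [r|r /sub]; [exact: reach_arc|exact: reach_pair].
Qed.

Lemma reach_insert K phi r x y : reach K (r |: phi) x y ->
  reach K phi x y || reach K phi x (tail r) && reach K phi (head r) y.
Proof.
move=> xy; apply: (reach_ind (P := fun y => reach K phi x y ||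
  reach K phi x (tail r) && reach K phi (head r) y) _ _ xy).
- move=> r' /setU1P[-> /orP[->|/andP[-> _]]|r'phi]; rewrite ?reach_refl ?orbT //.
  have th := reach_arc K r'phi.
  case/orP=> [xt|/andP[-> rt]]; first by rewrite (reach_trans xt th).
  by rewrite (reach_trans rt th) orbT.
- move=> r' rK; have th := reach_pair phi rK.
  case/orP=> [xt|/andP[-> rt]]; first by rewrite (reach_trans xt th).
  by rewrite (reach_trans rt th) orbT.
by rewrite reach_refl.
Qed.

Lemma reach_insert_redundant K phi r x y : reach K phi (tail r) (head r) ->
  reach K (r |: phi) x y = reach K phi x y.
Proof.
move=> tr; apply/idP/idP; last exact: reach_sub_arcs (subsetUr _ _).
case/reach_insert/orP => // /andP[xt hy].
exact: reach_trans xt (reach_trans tr hy).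
Qed.

Lemma valid_insert_redundant phi r : reach AB phi (tail r) (head r) ->
  valid A B (r |: phi) = valid A B phi.
Proof. by move=> tr; apply: valid_eq => q _; apply: reach_insert_redundant. Qed.

(** A walk from [q.2] to [q.1] through [r], closed by [q], would lead from the head of [r] to its
    tail. *)
Lemma reach_insert_free K phi r q : q \in K -> ~~ reach K phi (head r) (tail r) ->
  reach K (r |: phi) q.2 q.1 = reach K phi q.2 q.1.
Proof.
move=> qK nr; apply/idP/idP; last exact: reach_sub_arcs (subsetUr _ _).
case/reach_insert/orP => // /andP[qt hq]; case/negP: nr.
exact: reach_trans hq (reach_trans (reach_pair phi qK) qt).
Qed.

Lemma valid_insert_free phi r : ~~ reach AB phi (head r) (tail r) ->
  valid A B (r |: phi) = valid A B phi.
Proof. by move=> nr; apply: valid_eq => q qK; apply: reach_insert_free. Qed.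

(** After removing detours, a walk from [q.2] to [q.1] using one new arc would, closed by [q], join
    the ends of that arc within [phi]; one using both goes back and forth and can skip them. *)
Lemma valid_insert_both phi r r' : head r = tail r' -> tail r = head r' ->
  ~~ reach AB phi (head r) (tail r) -> ~~ reach AB phi (tail r) (head r) ->
  valid A B (r |: (r' |: phi)) = valid A B phi.
Proof.
move=> hr tr nht nth; apply: valid_eq => q qK; have th := reach_pair phi qK.
apply/idP/idP; last first.
  by apply: reach_sub_arcs; rewrite setUA; apply: subsetUr.
case/reach_insert/orP => [|/andP[]].
  by rewrite reach_insert_free // -hr -tr.
case/reach_insert/orP => [qt|/andP[qh _]].
  case/reach_insert/orP => [hq|/andP[_ tq]].
    by case/negP: nht; apply: reach_trans hq (reach_trans th qt).
  by apply: reach_trans qt _; rewrite tr.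
case/reach_insert/orP => [hq|/andP[_ tq]].
  by apply: reach_trans qh _; rewrite -hr.
by case/negP: nth; rewrite hr tr; apply: reach_trans tq (reach_trans th qh).
Qed.

End InsertArc.

(** * Edges on cycles and cuts; recovering a class after deletion or doubling *)

Section EdgeClasses.

Set Implicit Arguments.
Unset Strict Implicit.

Variable G : graph.
Local Notation V := (vertex G).
Local Notation E := (edge G).
Variables (A B : {set V * V}) (a b : bool) (e : E).
Local Notation AB := (A :|: B).
Local Notation requiv := (rev_equiv A B a b).
Implicit Types (phi chi th : fourientation G) (U W : {set V}) (K : {set V * V}).
Implicit Types (f : E) (x y z : V) (p : V -> nat) (s : pred bool) (d : bool).

(* Meant for [one_way e false phi].  The vertices out of reach from [src e], when
   the pairs of [A] and [B] may be used in both directions, then define an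
   (A, B)-cocycle, which contains [e] if [tgt e] is one of them. *)
Definition on_cycle phi := reach set0 phi (src e) (tgt e).
Definition on_cut phi := ~~ reach (AB_sym A B) phi (src e) (tgt e).

Lemma AB_subset_sym : AB \subset AB_sym A B. Proof. exact: subsetUl. Qed.

Lemma set_edge1 d phi : set_edge e (pred1 d) phi = (e, d) |: set_edge e pred0 phi.
Proof.
apply/setP => -[f d']; rewrite in_setU1 !in_set_edge xpair_eqE.
by case: eqVneq => //= _; rewrite orbF.
Qed.

Lemma set_edgeT d phi :
  set_edge e predT phi = (e, d) |: set_edge e (pred1 (~~ d)) phi.
Proof.
apply/setP => -[f d']; rewrite in_setU1 !in_set_edge xpair_eqE.
by case: eqVneq => //= _; case: d; case: d'.
Qed.

(** The arc of [e] leads back to [src e], so a walk starting there can omit it. *)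
Lemma reach_delete K phi x : one_way e false phi ->
  reach K phi (src e) x = reach K (set_edge e pred0 phi) (src e) x.
Proof.
move=> /one_wayP <-; rewrite set_edgeK set_edge1; apply/idP/idP.
  by case/reach_insert/orP => // /andP[].
exact: reach_sub_arcs (subsetUr _ _).
Qed.

(** Reachability is taken without [e]. If [src e] reaches [tgt e], there is no cut and the forward
    arc is redundant; if only the converse holds, there is no cycle and the backward arc is
    redundant. If neither holds, the four states are equally valid. *)
Lemma valid_states phi : one_way e false phi ->
  let P := a && on_cycle phi in let C := b && on_cut phi in
  valid A B (set_edge e (pred1 true) phi) + [&& ~~ P, ~~ C & valid A B phi] =
  (~~ C && valid A B (set_edge e pred0 phi)) + (~~ P && valid A B (set_edge e predT phi)).
Proof.
move=> ow; rewrite /on_cycle /on_cut !(reach_delete _ _ ow) /=.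
have := set_edge1 false phi; rewrite (one_wayP _ _ _ ow).
set phi0 := set_edge e pred0 phi => phiE.
have [uv|nuv] := boolP (reach AB phi0 (src e) (tgt e)).
  rewrite (reach_sub_pairs AB_subset_sym uv) andbF /= !set_edge1 -/phi0.
  rewrite (set_edgeT true) /= set_edge1 -/phi0.
  rewrite (valid_insert_redundant (r := (e, true)) uv).
  rewrite (valid_insert_redundant (r := (e, true)) (phi := (e, false) |: phi0)).
    by rewrite -phiE; case: (a && _); rewrite /= ?addn0.
  exact: reach_sub_arcs (subsetUr _ _) uv.
have nP : ~~ reach set0 phi0 (src e) (tgt e).
  by apply: contra nuv; apply: reach_sub_pairs; apply: sub0set.
rewrite (negPf nP) andbF /= (set_edgeT false) /= !set_edge1 -/phi0.
have [vu|nvu] := boolP (reach AB phi0 (tgt e) (src e)).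
  rewrite phiE (valid_insert_redundant (r := (e, false)) vu).
  rewrite (valid_insert_redundant (r := (e, false)) (phi := (e, true) |: phi0)).
    by rewrite addnC.
  exact: reach_sub_arcs (subsetUr _ _) vu.
rewrite (valid_insert_both (r := (e, false)) (r' := (e, true))) // phiE.
rewrite (valid_insert_free (r := (e, true)) nvu) (valid_insert_free (r := (e, false)) nuv).
by rewrite addnC.
Qed.

Lemma reach_tgt_src K phi : one_way e false phi -> reach K phi (tgt e) (src e).
Proof. by case/andP=> ephi _; apply: (reach_arc K ephi). Qed.

Lemma on_cycle_equiv phi chi : one_way e false phi -> requiv phi chi ->
  on_cycle phi -> on_cycle chi.
Proof. by move=> ow R uv; apply: equiv_reach R uv (reach_tgt_src _ ow); apply: sub0set. Qed.

Lemma on_cut_equiv phi chi : one_way e false chi -> requiv phi chi ->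
  on_cut phi -> on_cut chi.
Proof.
rewrite rev_equiv_sym => ow R; apply: contra => uv.
exact: equiv_reach R uv (reach_tgt_src _ ow).
Qed.

Lemma on_cut_cyc_rel phi chi : cyc_rel phi chi -> on_cut phi -> on_cut chi.
Proof. by move=> /cyc_rel_sym R; apply: contra; apply: cyc_rel_reach. Qed.

(* An edge on no cycle and no cut keeps its direction. *)
Lemma equiv_one_way phi chi : one_way e false phi ->
  ~~ (a && on_cycle phi) -> ~~ (b && on_cut phi) -> requiv phi chi ->
  one_way e false chi.
Proof.
move=> ow nP nC /rev_equivP[th R1 R2].
have [owt nCt] : one_way e false th /\ ~~ (b && on_cut th).
  case: (a) R1 nP => [R1 /= nP|<- //]; split; last first.
    by apply: contra nC => /andP[-> /=]; apply: on_cut_cyc_rel (cyc_rel_sym R1).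
  have Wc : out_closed phi [set y | reach set0 phi (src e) y].
    exact: reach_out_closed.
  have agree d : ((e, d) \in phi) = ((e, d) \in th).
    apply: (cyc_rel_agree R1 Wc); rewrite !inE.
    by case: d; rewrite /tail /head /= reach_refl -/(on_cycle phi) (negPf nP).
  by rewrite /one_way -!agree.
case: (b) R2 nCt => [[p pot]|<- //]; rewrite /= negbK => uv.
have pK := potential_AB_sym pot.
have pe : p (src e) = p (tgt e).
  apply/eqP; rewrite eqn_leq (potential_reach_le pot pK uv).
  by rewrite (potential_reach_le pot pK (reach_tgt_src _ owt)).
have := potential_arc (a := (e, false)) pot; rewrite (one_way_in _ owt) => /(_ isT).
have [/(_ e)deg _ _] := pot; move: deg; rewrite !(one_way_in _ owt) /one_way.
by rewrite /tail /head /= pe; lia.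
Qed.

(** Walks from [src e] to [tgt e] avoiding [e] exist on both sides: the one in [th] cannot increase
    [p] and the one in [chi] cannot decrease it. So [p] is equal at the ends of [e], which can be
    put back. *)
Lemma potential_merge p th chi : one_way e false th -> one_way e false chi ->
  ~~ on_cut th -> ~~ on_cut chi ->
  potential AB p (set_edge e pred0 th) (set_edge e pred0 chi) -> potential AB p th chi.
Proof.
move=> owt owc; rewrite /on_cut !negbK (reach_delete _ _ owt) (reach_delete _ _ owc) => uv uv' pot.
have pK := potential_AB_sym pot.
have pe : p (src e) = p (tgt e).
  apply/eqP; rewrite eqn_leq (potential_reach_le pot pK uv).
  by rewrite (potential_reach_ge pot pK uv').
rewrite -((one_wayP _ _ _) owt) -((one_wayP _ _ _) owc) -(set_edgeK e _ pred0 th).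
by rewrite -(set_edgeK e _ pred0 chi); apply: potential_set_edge.
Qed.

Lemma equiv_delete_inj phi chi : one_way e false phi -> one_way e false chi ->
  ~~ (b && on_cut phi) -> ~~ (b && on_cut chi) ->
  requiv (set_edge e pred0 phi) (set_edge e pred0 chi) -> requiv phi chi.
Proof.
move=> owp owc nCp nCc /rev_equivP[th0 R1 R2].
have [th owt th0E] : exists2 th, one_way e false th & th0 = set_edge e pred0 th.
  exists (set_edge e (pred1 false) th0); first exact: one_way_set_edge.
  rewrite set_edgeK set_edge_id // => d.
  have deg : same_degree (set_edge e pred0 phi) th0 by case: (a) R1 => [[]|->].
  by have := deg e; rewrite !in_set_edge eqxx; case: d => /=; case: (_ \in _); lia.
rewrite {}th0E in R1 R2.
have R1' : if a then cyc_rel phi th else phi = th.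
  rewrite -((one_wayP _ _ _) owp) -((one_wayP _ _ _) owt).
  case: (a) R1 => [/cyc_rel_insert|eq0]; first exact.
  by rewrite -(set_edgeK e _ pred0 phi) eq0 set_edgeK.
apply/rev_equivP; exists th => //.
case: (b) nCp nCc R2 => /= nCp nCc R2; last first.
  rewrite -((one_wayP _ _ _) owc) -((one_wayP _ _ _) owt).
  by rewrite -(set_edgeK e _ pred0 th) R2 set_edgeK.
have [p pot] := R2; exists p; apply: potential_merge => //.
by apply: contra nCp; case: (a) R1' => [/cyc_rel_sym/on_cut_cyc_rel|->]; apply.
Qed.

Lemma out_closed_le phi chi W :
  same_degree phi chi -> out_closed phi W -> out_count phi W <= out_count chi W.
Proof.
move=> deg Wc; apply: leq_sum => f _.
by move: (Wc (f, true)) (Wc (f, false)) (deg f); rewrite /outs /tail /head /=; lia.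
Qed.

Lemma out_count_setID phi U W :
  out_count phi U = out_count phi (U :&: W) + out_count phi (U :\: W).
Proof.
rewrite /out_count -big_split; apply: eq_bigr => f _; rewrite /outs !inE /=.
by case: (src f \in W); case: (tgt f \in W); rewrite ?andbT ?andbF /=; lia.
Qed.

(** For [uncut] sets containing [src e] but not [tgt e], the counts in [phi] and [chi] differ by a
    constant. The closed sets reached from [src e] in [phi] and in [chi] give it opposite signs, so
    it is zero. *)
Lemma cyc_rel_uncontract phi chi : one_way e false phi -> one_way e false chi ->
  ~~ on_cycle phi -> ~~ on_cycle chi ->
  cyc_rel (set_edge e predT phi) (set_edge e predT chi) -> cyc_rel phi chi.
Proof.
move=> owp owc nPp nPc [deg N].
have {deg} deg : same_degree phi chi.
  rewrite -((one_wayP _ _ _) owp) -((one_wayP _ _ _) owc).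
  rewrite -(set_edgeK e _ predT phi) -(set_edgeK e _ predT chi).
  exact: same_degree_set_edge.
have same U : uncut phi U -> (src e \in U) = (tgt e \in U) ->
    out_count phi U = out_count chi U.
  move=> Uc eU; have UcT : uncut (set_edge e predT phi) U.
    by move=> f; rewrite !in_set_edge; case: eqP => [-> //|_]; apply: Uc.
  have := out_count_set_edge e predT phi U; have := out_count_set_edge e predT chi U.
  rewrite (N U UcT) (outs_one_way _ owp) (outs_one_way _ owc); lia.
(* The differences of [U] and [W] contain neither end of [e], so [same] applies to them and the
   common part cancels. *)
have sep U W : uncut phi U -> uncut phi W -> src e \in U -> tgt e \notin U ->
    src e \in W -> tgt e \notin W ->
    out_count phi U + out_count chi W = out_count chi U + out_count phi W.
  move=> Uc Wc sU tU sW tW.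
  have UD : out_count phi (U :\: W) = out_count chi (U :\: W).
    apply: same; last by rewrite !inE sW (negPf tU) andbF.
    by move=> f ft ff; rewrite !inE (Uc f) // (Wc f).
  have WD : out_count phi (W :\: U) = out_count chi (W :\: U).
    apply: same; last by rewrite !inE sU (negPf tW) andbF.
    by move=> f ft ff; rewrite !inE (Uc f) // (Wc f).
  rewrite (out_count_setID phi U W) (out_count_setID chi U W).
  rewrite (out_count_setID phi W U) (out_count_setID chi W U) setIC UD WD; lia.
pose Wp := [set y | reach set0 phi (src e) y].
pose Wc := [set y | reach set0 chi (src e) y].
have Wpc : out_closed phi Wp by apply: reach_out_closed.
have Wcc : out_closed chi Wc by apply: reach_out_closed.
have lep := out_closed_le deg Wpc.
have lec := out_closed_le (same_degree_sym deg) Wcc.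
have uWp := out_closed_uncut Wpc.
have uWc := same_degree_uncut (same_degree_sym deg) (out_closed_uncut Wcc).
have [sWp tWp] : src e \in Wp /\ tgt e \notin Wp by rewrite !inE reach_refl.
have [sWc tWc] : src e \in Wc /\ tgt e \notin Wc by rewrite !inE reach_refl.
have out U : uncut phi U -> src e \in U -> tgt e \notin U ->
    out_count phi U = out_count chi U.
  move=> Uc sU tU.
  move: lep lec (sep _ _ Uc uWp sU tU sWp tWp) (sep _ _ Uc uWc sU tU sWc tWc).
  by clear; lia.
split=> // U Uc; have [eU|] := eqVneq (src e \in U) (tgt e \in U); first exact: same.
have [sU|sU] := boolP (src e \in U); case: (boolP (tgt e \in U)) => // tU _.
  exact: out.
(* A set containing only [tgt e] is treated through its complement. *)
have tot : out_count phi setT = out_count chi setT.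
  by apply: same => [f _ _|]; rewrite !inE.
have := out_count_setID phi setT U; have := out_count_setID chi setT U.
rewrite tot !setTI !setTD (out (~: U)) ?inE ?tU //; first by clear; lia.
by move=> f ft ff; rewrite !inE (Uc f).
Qed.

(** The potential carries over at once, a 2-way [e] forcing equal values at its ends. The cycle
    stage is recovered by [cyc_rel_uncontract]. *)
Lemma equiv_contract_inj phi chi : one_way e false phi -> one_way e false chi ->
  ~~ (a && on_cycle phi) -> ~~ (a && on_cycle chi) ->
  requiv (set_edge e predT phi) (set_edge e predT chi) -> requiv phi chi.
Proof.
move=> owp owc nPp nPc /rev_equivP[th2 R1 R2].
have [th owt th2E] : exists2 th, one_way e false th & th2 = set_edge e predT th.
  exists (set_edge e (pred1 false) th2); first exact: one_way_set_edge.
  rewrite set_edgeK set_edge_id // => d.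
  have deg : same_degree (set_edge e predT phi) th2 by case: (a) R1 => [[]|->].
  by have := deg e; rewrite !in_set_edge eqxx; case: d => /=; case: (_ \in _); lia.
rewrite {}th2E in R1 R2.
have R2' : if b then coc_rel AB th chi else th = chi.
  case: (b) R2 => [[p pot]|eq2]; last first.
    rewrite -((one_wayP _ _ _) owc) -((one_wayP _ _ _) owt).
    by rewrite -(set_edgeK e _ predT th) eq2 set_edgeK.
  exists p; rewrite -((one_wayP _ _ _) owc) -((one_wayP _ _ _) owt).
  rewrite -(set_edgeK e _ predT th) -(set_edgeK e _ predT chi).
  apply: potential_set_edge => //; have [_ _ /(_ e)] := pot.
  by rewrite !in_set_edge eqxx => /(_ isT); lia.
apply/rev_equivP; exists th => //.
case: (a) nPp nPc R1 => /= nPp nPc R1; last first.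
  rewrite -((one_wayP _ _ _) owp) -((one_wayP _ _ _) owt).
  by rewrite -(set_edgeK e _ predT phi) R1 set_edgeK.
apply: cyc_rel_uncontract => //; apply: contra nPc => uv.
case: (b) R2' => [[p pot]|<- //].
by apply: (potential_reach pot) uv (reach_tgt_src _ owt) => r; rewrite inE.
Qed.

End EdgeClasses.

(** * Reaching the extremal representatives *)

Section Exclusions.

Set Implicit Arguments.
Unset Strict Implicit.

Variable G : graph.
Local Notation V := (vertex G).
Local Notation E := (edge G).
Variables (A B : {set V * V}) (a b : bool) (e : E).
Local Notation AB := (A :|: B).
Local Notation requiv := (rev_equiv A B a b).
Implicit Types (phi chi th y : fourientation G) (U W : {set V}) (K : {set V * V}).
Implicit Types (f : E) (x z : V) (p : V -> nat) (s : pred bool) (d : bool).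
Implicit Types (c : seq (arc G)) (g : arc G).

Lemma same_degree_zero_way phi chi : same_degree phi chi -> zero_way phi = zero_way chi.
Proof. by move=> deg; apply/setP => f; rewrite !inE; move: (deg f); lia. Qed.

Lemma same_degree_two_way phi chi : same_degree phi chi -> two_way phi = two_way chi.
Proof. by move=> deg; apply/setP => f; rewrite !inE; move: (deg f); lia. Qed.

Lemma in_solid phi f : (f \in solid phi) = (((f, true) \in phi) == ((f, false) \in phi)).
Proof. by rewrite !inE; case: ((f, true) \in phi); case: ((f, false) \in phi). Qed.

Lemma two_way_cycle_sub phi chi :
  two_way phi \subset two_way chi -> two_way_cycle phi -> two_way_cycle chi.
Proof.
move=> /subsetP sub /some_closed_pathP[c [cc /andP[gc /allP call]]].
apply/some_closed_pathP; exists c; rewrite gc; split=> //=.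
by apply/allP => g /call /sub.
Qed.

Lemma zero_way_cocycle_sub phi chi : zero_way phi \subset zero_way chi ->
  zero_way_cocycle A B phi -> zero_way_cocycle A B chi.
Proof.
move=> sub /existsP[W /and3P[cN cz cK]]; apply/existsP; exists W.
by rewrite cN cK (subset_trans cz sub).
Qed.

Definition allowed phi :=
  ~~ (a && two_way_cycle phi) && ~~ (b && zero_way_cocycle A B phi).

Lemma allowed_sub phi chi : two_way phi \subset two_way chi ->
  zero_way phi \subset zero_way chi -> allowed chi -> allowed phi.
Proof.
move=> st sz /andP[nt nz]; apply/andP; split.
  by apply: contra nt => /andP[-> /(two_way_cycle_sub st)].
by apply: contra nz => /andP[-> /(zero_way_cocycle_sub sz)].
Qed.

Lemma same_degree_allowed phi chi : same_degree phi chi -> allowed phi = allowed chi.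
Proof.
move=> deg; apply/idP/idP; apply: allowed_sub;
by rewrite (same_degree_zero_way deg, same_degree_two_way deg).
Qed.

Lemma same_degree_solid phi chi : same_degree phi chi -> solid phi = solid chi.
Proof.
by move=> deg; rewrite /solid (same_degree_zero_way deg) (same_degree_two_way deg).
Qed.

Lemma flip_cycle phi : one_way e false phi -> on_cycle e phi ->
  exists2 chi, one_way e true chi & cyc_rel phi chi.
Proof.
move=> ow uv; have ephi : (e, false) \in phi by rewrite (one_way_in _ ow).
have [c cc /andP[ec cphi]] := closed_path_through (a := (e, false)) ephi uv.
exists (reverse (cycle_edges c) phi); last exact: cyc_rel_reverse.
by rewrite /one_way !in_reverse in_cycle_edges ec orbT !(one_way_in _ ow).
Qed.

(** [W] is made explicit because the growth of the potential at [tgt e], and not at [src e], ensures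
    termination in [exists_not_on_cut]. *)
Lemma flip_cut phi : one_way e false phi -> on_cut A B e phi ->
  exists chi W, [/\ one_way e true chi, potential AB (fun x => x \in W) phi chi,
    src e \notin W & tgt e \in W].
Proof.
move=> ow uv; pose W := ~: [set x | reach (AB_sym A B) phi (src e) x].
have [sW tW] : src e \notin W /\ tgt e \in W by rewrite !inE reach_refl.
have side : source_side A B phi W.
  split=> [g gphi|r rAB]; rewrite !inE.
    by apply: contra => /reach_trans; apply; apply: reach_arc.
  congr (~~ _); apply/idP/idP => /reach_trans; apply.
    by apply: reach_pair; rewrite inE rAB.
  have rK : (r.2, r.1) \in AB_sym A B.
    by apply/setUP; right; apply/imsetP; exists r.
  exact: (reach_pair phi rK).
exists (reverse_cut A B phi W), W; split=> //; last exact: potential_reverse_cut.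
rewrite /one_way !in_reverse in_cocycle_edges !(one_way_in _ ow).
by rewrite (negPf sW) tW.
Qed.

Lemma cyc_rel_equiv phi chi : a -> cyc_rel phi chi -> requiv phi chi.
Proof.
move=> aT R; apply/rev_equivP; rewrite aT; exists chi => //.
by case: (b) => //; apply: coc_rel_refl.
Qed.

Lemma coc_rel_equiv phi chi : b -> coc_rel AB phi chi -> requiv phi chi.
Proof.
move=> bT R; apply/rev_equivP; rewrite bT; exists phi => //.
by case: (a) => //; apply: cyc_rel_refl.
Qed.

(* The level sets of [p] separating the ends of [e] are crossed by edges which
   are not 0-way, along which [p] varies by at most 1. *)
Lemma potential_bound p y chi : ~~ zero_way_cocycle A B y ->
  potential AB p y chi -> p (tgt e) <= p (src e) + #|V|.
Proof.
move=> nz [_ pK pE]; rewrite -leq_subLR.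
(* Every integer above [p (src e)] and up to [p (tgt e)] is shown to be a value of [p], so there are
   at most [#|V|] of them. *)
rewrite -(size_iota (p (src e)).+1 (p (tgt e) - p (src e))) cardE -(size_map p).
apply: uniq_leq_size (iota_uniq _ _) _ => k; rewrite mem_iota => kp.
pose W := [set x | k <= p x].
have [sW tW] : src e \notin W /\ tgt e \in W by rewrite !inE; lia.
have: ~~ (cut W \subset zero_way y).
  apply: contra nz => cW; apply/existsP; exists W; rewrite cW /=; apply/andP; split.
    by apply/set0Pn; exists e; rewrite inE tW (negPf sW).
  by apply/forall_inP => r /pK; rewrite !inE => ->.
case/subsetPn => f; rewrite !inE => fW fz.
have fy : ((f, true) \in y) || ((f, false) \in y) by lia.
suff [x <-] : exists x, p x = k by apply: map_f; rewrite mem_enum.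
have [pk|pk] := eqVneq (p (src f)) k; first by exists (src f).
have [pk'|pk'] := eqVneq (p (tgt f)) k; first by exists (tgt f).
by move: (pE f fy) fW pk pk'; clear; lia.
Qed.

(** While [e] is on a cut, reverse this cut and direct [e] backward again. With [e] deleted, these
    are cut reversals from [y]; their total potential gains one at [tgt e] relative to [src e] each
    time, which [potential_bound] limits. *)
Lemma exists_not_on_cut y : (e, true) \notin y -> (e, false) \notin y ->
  ~~ (b && zero_way_cocycle A B y) ->
  exists phi, [/\ one_way e false phi, ~~ (b && on_cut A B e phi)
    & requiv y (set_edge e pred0 phi)].
Proof.
move=> yt yf; have yE : set_edge e pred0 (set_edge e (pred1 false) y) = y.
  by rewrite set_edgeK set_edge_id // => -[] /=; rewrite (negPf yt, negPf yf).
have ow := one_way_set_edge e false y.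
case bE: b => /= nz; last first.
  exists (set_edge e (pred1 false) y); split=> //.
  by rewrite yE /rev_equiv connect0.
suff [phi [owp nC R]] : exists phi, [/\ one_way e false phi, ~~ on_cut A B e phi
    & coc_rel AB y (set_edge e pred0 phi)].
  by exists phi; split=> //; rewrite -bE; apply: coc_rel_equiv.
have: potential AB (fun=> 0) y (set_edge e pred0 (set_edge e (pred1 false) y)).
  by rewrite yE; split.
move: (set_edge e (pred1 false) y) ow (fun=> 0 : nat) => {yE} phi + p.
move: {2}_.+1 (ltnSn (p (src e) + #|V| - p (tgt e))) => n.
elim: n phi p => // n IHn phi p; rewrite ltnS => len ow pot.
have [uv|nC] := boolP (on_cut A B e phi); last by exists phi; split=> //; exists p.
have [chi [W [owc potW sW tW]]] := flip_cut ow uv.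
have pot' := potential_trans pot (potential_delete e potW).
rewrite -(set_edgeK e pred0 (pred1 false)) in pot'.
apply: IHn pot'; last exact: one_way_set_edge.
rewrite /= tW (negPf sW) addn0 addn1.
have := potential_bound nz (potential_trans pot (potential_delete e potW)).
by rewrite /= tW (negPf sW) addn0 addn1 => lt; rewrite subnS prednK ?subn_gt0.
Qed.

Definition two_way_arcs phi : fourientation G :=
  [set g in phi | (g.1, ~~ g.2) \in phi].

Lemma in_two_way_arcs phi g : (g \in two_way_arcs phi) = (g.1 \in two_way phi).
Proof. by case: g => f []; rewrite !inE //= andbC. Qed.

Lemma reach_two_way_sym phi x z :
  reach set0 (two_way_arcs phi) x z -> reach set0 (two_way_arcs phi) z x.
Proof.
move=> xz; apply: (reach_ind (P := fun z => reach set0 (two_way_arcs phi) z x) _ _ xz).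
- move=> [f d]; rewrite in_two_way_arcs => ft; apply: reach_trans.
  have ra d' : reach set0 (two_way_arcs phi) (tail (f, d')) (head (f, d')).
    by apply: reach_arc; rewrite in_two_way_arcs.
  by case: d {ft}; [have := ra false | have := ra true].
- by move=> r; rewrite inE.
exact: reach_refl.
Qed.

(* A closed path using an edge in both directions is that edge back and forth. *)
Lemma closed_path_back_forth c f g : closed_path c ->
  (f, true) \in c -> (f, false) \in c -> g \in c -> g.1 = f.
Proof.
case/and3P=> _ + + /rot_to[i s cE]; rewrite -(rot_uniq i) -map_rot -(rot_cycle i).
rewrite -!(mem_rot i c) cE; case: s {cE} => [|h [|k s]] /=.
- by move=> _ _; rewrite inE xpair_eqE andbF.
- by rewrite !inE xpair_eqE andbF => _ _ /eqP <- /orP[]/eqP->.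
rewrite !inE !negb_or xpair_eqE andbF /=.
move=> /and4P[/and3P[_ nk _] /andP[nh nhs] _ _] /and3P[/eqP th /eqP tk _].
case/or3P=> [/eqP hE|/eqP kE|fs].
- by case/eqP: nk; rewrite -tk -hE.
- by case/eqP: nh; rewrite -th -kE.
by case/negP: nhs; rewrite -th; apply: (map_f (@tail G) fs).
Qed.

(** [closed_path_through] only provides distinct tails. Avoiding one direction of [e] rules out the
    back and forth path, the only obstacle to a cycle of [G]. *)
Lemma closed_path_uniq_edges c : closed_path c ->
  (e, false) \in c -> (e, true) \notin c -> uniq (map fst c).
Proof.
move=> cc ec nec; have uc : uniq c by case/and3P: cc => _ /map_uniq.
rewrite map_inj_in_uniq // => -[f d] [f' d'] fc f'c /= ff; subst f'.
have [->//|dd] := eqVneq d d'.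
have [ft ff] : (f, true) \in c /\ (f, false) \in c by case: d d' dd fc f'c => -[].
by case/negP: nec; rewrite (closed_path_back_forth cc ft ff ec : e = f).
Qed.

Lemma two_way_cycle_reach phi y : two_way phi \subset two_way y -> e \in two_way y ->
  e \notin two_way phi -> reach set0 (two_way_arcs phi) (src e) (tgt e) ->
  two_way_cycle y.
Proof.
move=> /subsetP sub ey ephi uv; pose D := (e, false) |: two_way_arcs phi.
have eD : (e, false) \in D by rewrite setU11.
have uvD : reach set0 D (head (e, false)) (tail (e, false)).
  exact: reach_sub_arcs (subsetUr _ _) uv.
have [c cc /andP[ec /allP cD]] := closed_path_through eD uvD.
apply/some_closed_pathP; exists c; rewrite /graph_cycle cc; split=> //=.
rewrite closed_path_uniq_edges //=.
  apply/allP => g /cD; rewrite in_setU1 in_two_way_arcs => /orP[/eqP-> //|].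
  exact: sub.
apply: contra ephi => /cD; rewrite in_setU1 in_two_way_arcs.
by case/orP => [/eqP[]|].
Qed.

Lemma path_reach (D : fourientation G) g (s : seq (arc G)) :
  path (fun g h => head g == tail h) g s -> all [in D] s ->
  reach set0 D (head g) (head (last g s)).
Proof.
elim: s g => [|h s IHs] g /=; first by rewrite reach_refl.
move=> /andP[/eqP gh sp] /andP[hD sD]; rewrite gh.
exact: reach_trans (reach_arc _ hD) (IHs _ sp sD).
Qed.

(** If the cycle uses [e], its other edges are 2-way in [phi] and can be followed either way, in
    particular from [src e] to [tgt e]. *)
Lemma two_way_cycle_contract phi : one_way e false phi ->
  two_way_cycle (set_edge e predT phi) -> two_way_cycle phi || on_cycle e phi.
Proof.
move=> ow /some_closed_pathP[c [cc /andP[/andP[_ uc] /allP ct]]].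
have tw g : g.1 != e -> g.1 \in two_way (set_edge e predT phi) -> g.1 \in two_way phi.
  by case: g => f d /= fe; rewrite !inE /= (negPf fe).
have [/mapP[g gc eg]|ec] := boolP (e \in map fst c); last first.
  apply/orP; left; apply/some_closed_pathP; exists c.
  rewrite cc /graph_cycle cc uc; split=> //=; apply/allP => g gc.
  apply: tw (ct _ gc); apply: contra ec => /eqP <-; exact: map_f.
apply/orP; right; have [i s cE] := rot_to gc.
have [cc' uc'] : cycle (fun g h => head g == tail h) (g :: s) /\ uniq (map fst (g :: s)).
  by rewrite -cE rot_cycle map_rot rot_uniq; case/and3P: cc.
have {ct}ct h : h \in s -> h.1 \in two_way phi.
  move=> hs; apply: tw; last by apply: ct; rewrite -(mem_rot i) cE inE hs orbT.
  by apply: contraTneq uc' => he /=; rewrite -eg -he map_f.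
have sD : all [in two_way_arcs phi] s.
  by apply/allP => h /ct; rewrite /= in_two_way_arcs.
move: cc'; rewrite /= rcons_path => /andP[sp /eqP lg].
have := path_reach sp sD; rewrite lg /on_cycle.
have sub : two_way_arcs phi \subset phi by apply/subsetP => h; rewrite inE => /andP[].
case: g eg {gc cE uc' sp lg} => f [] /= <-; last exact: reach_sub_arcs.
by move/reach_two_way_sym; apply: reach_sub_arcs.
Qed.

(** While [e] is on a cycle, reverse this cycle and direct [e] backward again; with [e] doubled,
    this is a cycle equivalence. The component [U] of [src e] for the other 2-way edges misses
    [tgt e], as [y] has no 2-way cycle, so each round lowers the count for [U] by one. *)
Lemma exists_not_on_cycle y : (e, true) \in y -> (e, false) \in y ->
  ~~ (a && two_way_cycle y) ->
  exists phi, [/\ one_way e false phi, ~~ (a && on_cycle e phi)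
    & requiv y (set_edge e predT phi)].
Proof.
move=> yt yf; have yE : set_edge e predT (set_edge e (pred1 false) y) = y.
  by rewrite set_edgeK set_edge_id // => -[]; rewrite (yt, yf).
have ow := one_way_set_edge e false y.
case aE: a => /= nt; last first.
  exists (set_edge e (pred1 false) y); split=> //.
  by rewrite yE /rev_equiv connect0.
suff [phi [owp nC R]] : exists phi, [/\ one_way e false phi, ~~ on_cycle e phi
    & cyc_rel y (set_edge e predT phi)].
  by exists phi; split=> //; rewrite -aE; apply: cyc_rel_equiv.
set y1 := set_edge e (pred1 false) y in yE ow.
pose U := [set x | reach set0 (two_way_arcs y1) (src e) x].
have [sU tU] : src e \in U /\ tgt e \notin U.
  rewrite !inE reach_refl; split=> //; apply: contra nt; apply: two_way_cycle_reach.
  - by apply/subsetP => f; rewrite !inE /=; case: eqP => // ->.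
  - by rewrite inE yt yf.
  by rewrite !inE /= eqxx.
have Uc : uncut y1 U.
  have Du : uncut (two_way_arcs y1) U by apply/out_closed_uncut/reach_out_closed.
  by move=> f ft ff; apply: Du; rewrite in_two_way_arcs inE ft ff.
have : cyc_rel y (set_edge e predT y1) by rewrite yE; apply: cyc_rel_refl.
move: {2}_.+1 (ltnSn (out_count y1 U)) => n.
clear yE; clearbody U; clearbody y1.
elim: n y1 ow Uc => // n IHn phi ow Uc; rewrite ltnS => len R.
have [uv|nP] := boolP (on_cycle e phi); last by exists phi.
have [chi owc Rc] := flip_cycle ow uv; have [deg N] := Rc.
apply: (IHn (set_edge e (pred1 false) chi)); first exact: one_way_set_edge.
- move=> f; rewrite !in_set_edge; case: eqP => // _.
  exact: (same_degree_uncut deg Uc).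
- have := out_count_set_edge e (pred1 false) chi U.
  rewrite (outs_one_way _ owc) -(N U Uc) /tail /= sU (negPf tU) addn0 => eqN.
  by apply: leq_trans len; rewrite -eqN addn1.
rewrite set_edgeK; apply: cyc_rel_trans R _.
by apply: cyc_rel_set_edge ow owc _ Rc.
Qed.

End Exclusions.

(** * Comparing the solid sets [S] and [e |: S] *)

Section Counting.

Set Implicit Arguments.
Unset Strict Implicit.

Variable G : graph.
Local Notation V := (vertex G).
Local Notation E := (edge G).
Variables (A B : {set V * V}) (a b : bool).
Local Notation AB := (A :|: B).
Local Notation requiv := (rev_equiv A B a b).
Local Notation allowed := (allowed A B a b).
Implicit Types (phi chi y : fourientation G) (e f : E) (d : bool) (S : {set E}).

(** Without [e], a walk still leads from [src e] to [tgt e]. Neither its arcs nor its pairs cross a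
    0-way cocycle, so [e] does not cross it either. *)
Lemma zero_way_cocycle_delete e phi : one_way e false phi -> ~~ on_cut A B e phi ->
  zero_way_cocycle A B (set_edge e pred0 phi) -> zero_way_cocycle A B phi.
Proof.
move=> ow; rewrite /on_cut negbK (reach_delete _ _ ow) => uv.
case/existsP => W /and3P[cN /subsetP cz /forall_inP cK].
have eW : e \notin cut W.
  rewrite inE negbK; apply: (reach_ind
    (P := fun x => (src e \in W) == (x \in W)) _ _ uv) => //.
    move=> [f d] fd /eqP ->; rewrite -[_ == _]negbK; apply/negP => fW.
    have /cz : f \in cut W by move: fW; rewrite inE; case: (d); rewrite // eq_sym.
    by move: fd; rewrite !inE /=; case: (d) => ->; rewrite ?andbF.
  move=> r /setUP[/cK/eqP <- //|/imsetP[r' /cK/eqP r'W ->]] /eqP ->.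
  by rewrite /= r'W.
apply/existsP; exists W; rewrite cN /=; apply/andP; split; last by apply/forall_inP.
apply/subsetP => f fW; have := cz f fW; rewrite !inE /=.
by case: eqP => // fe; rewrite -fe fW in eW.
Qed.

Lemma allowed_delete e phi : one_way e false phi -> allowed phi ->
  ~~ (b && on_cut A B e phi) -> allowed (set_edge e pred0 phi).
Proof.
move=> ow /andP[nt nz] nC; apply/andP; split.
  apply: contra nt => /andP[-> /=]; apply: two_way_cycle_sub.
  by apply/subsetP => f; rewrite !inE /=; case: eqP.
apply: contra nz => /andP[bT]; rewrite bT in nC *.
exact: zero_way_cocycle_delete.
Qed.

Lemma allowed_contract e phi : one_way e false phi -> allowed phi ->
  ~~ (a && on_cycle e phi) -> allowed (set_edge e predT phi).
Proof.
move=> ow /andP[nt nz] nP; apply/andP; split.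
  apply: contra nt => /andP[aT]; rewrite aT /= in nP *.
  by move/(two_way_cycle_contract ow); rewrite (negPf nP) orbF.
apply: contra nz => /andP[-> /=]; apply: zero_way_cocycle_sub.
by apply/subsetP => f; rewrite !inE /=; case: eqP.
Qed.

Lemma solid_set_edge e s phi : solid (set_edge e s phi) =
  if s true == s false then e |: solid phi else solid phi :\ e.
Proof.
apply/setP => f; rewrite in_solid !in_set_edge.
by case sE: (s true == s false); rewrite (in_setU1, in_setD1) in_solid;
  case: (f =P e) => //=; rewrite ?sE.
Qed.

Lemma one_way_solid e phi :
  (e \in solid phi) = ~~ (one_way e true phi || one_way e false phi).
Proof.
by rewrite in_solid /one_way /=; case: ((e, true) \in phi); case: ((e, false) \in phi).
Qed.

Lemma allowed_one_way e d s phi : one_way e d phi -> s true == s false ->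
  allowed (set_edge e s phi) -> allowed phi.
Proof.
move=> ow sE; apply: allowed_sub; apply/subsetP => f; rewrite !inE /=;
by case: eqP => // ->; rewrite !(one_way_in _ ow); case: (d).
Qed.

Lemma solid_one_way e d s phi S : one_way e d phi -> s true == s false ->
  solid (set_edge e s phi) = e |: S -> e \notin S -> solid phi = S.
Proof.
move=> ow sE + eS; rewrite solid_set_edge sE => /(congr1 (fun T => T :\ e)).
by rewrite !setU1K // one_way_solid negbK; case: d ow => ->; rewrite ?orbT.
Qed.

Definition four S : {set fourientation G} :=
  [set phi | [&& valid A B phi, allowed phi & solid phi == S]].

Lemma four_closed S x y : requiv x y -> x \in four S -> y \in four S.
Proof.
move=> R; have deg := equiv_same_degree R; rewrite !inE.
by rewrite (equiv_valid R) (same_degree_allowed _ _ _ _ deg) (same_degree_solid deg).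
Qed.

Section OneEdge.

Variables (S : {set E}) (e : E).
Hypothesis eS : e \notin S.

(** Validity is left out: it may differ between the states of [e], and a single transversal must
    serve all four counts. *)
Definition backward : {set fourientation G} :=
  [set phi | [&& one_way e false phi, allowed phi & solid phi == S]].

Let P phi := a && on_cycle e phi.
Let C phi := b && on_cut A B e phi.

Lemma on_cycle_backward : {in backward &, forall x y, requiv x y -> P x = P y}.
Proof.
move=> x y /[!inE] /andP[owx _] /andP[owy _] R; congr (_ && _).
have R' := R; rewrite rev_equiv_sym in R'.
by apply/idP/idP; [apply: on_cycle_equiv owx R | apply: on_cycle_equiv owy R'].
Qed.

Lemma on_cut_backward : {in backward &, forall x y, requiv x y -> C x = C y}.
Proof.
move=> x y /[!inE] /andP[owx _] /andP[owy _] R; congr (_ && _).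
have R' := R; rewrite rev_equiv_sym in R'.
by apply/idP/idP; [apply: on_cut_equiv owy R | apply: on_cut_equiv owx R'].
Qed.

Lemma same_degree_set_edge1 d d' phi : one_way e d phi ->
  same_degree phi (set_edge e (pred1 d') phi).
Proof.
move=> ow f; rewrite !in_set_edge; case: eqP => // ->.
by rewrite !(one_way_in _ ow); case: d {ow}; case: d'.
Qed.

Lemma one_way_set_edgeK d s phi : one_way e d phi ->
  set_edge e (pred1 d) (set_edge e s phi) = phi.
Proof. by move=> ow; rewrite set_edgeK; apply/one_wayP. Qed.

Variable X : {set fourientation G}.
Hypothesis tX : transversal_of requiv backward X.

Lemma nclasses_forward :
  nclasses requiv [set phi in four S | one_way e true phi] =
  \sum_(x in X) valid A B (set_edge e (pred1 true) x).
Proof.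
apply: (nclasses_transversal (rev_equiv_equivalence A B a b) (f := set_edge e (pred1 true))
  (p := fun x => valid A B (set_edge e (pred1 true) x)) tX).
- move=> x /[!inE] /and3P[ow al sx] v; have deg := same_degree_set_edge1 true ow.
  by rewrite one_way_set_edge v -(same_degree_allowed _ _ _ _ deg)
    -(same_degree_solid deg) al sx.
- move=> x y /[!inE] /andP[owx _] /andP[owy _] _ _ R.
  have := equiv_set_edge (pred1 false) (one_way_set_edge e true x) (one_way_set_edge e true y) R.
  by rewrite !one_way_set_edgeK.
- move=> x y /[!inE] /andP[owx _] /andP[owy _] R.
  have R' := equiv_set_edge (pred1 true) owx owy R.
  by rewrite (equiv_valid R').
move=> y /[!inE] /andP[/and3P[v al sy] ow]; exists (set_edge e (pred1 false) y).
have deg := same_degree_set_edge1 false ow.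
rewrite !inE one_way_set_edge set_edgeK (one_wayP _ _ _ ow) v.
rewrite -(same_degree_allowed _ _ _ _ deg) -(same_degree_solid deg) al sy.
by split=> //; apply: connect0.
Qed.

Lemma nclasses_backward :
  nclasses requiv [set phi in four S | [&& one_way e false phi, ~~ P phi & ~~ C phi]] =
  \sum_(x in X) [&& ~~ P x, ~~ C x & valid A B x].
Proof.
apply: (nclasses_transversal (rev_equiv_equivalence A B a b) (f := id)
  (p := fun x => [&& ~~ P x, ~~ C x & valid A B x]) tX) => //.
- by move=> x /[!inE] /and3P[-> -> ->] /and3P[-> -> ->].
- move=> x y xb yb R.
  by rewrite (on_cycle_backward xb yb R) (on_cut_backward xb yb R) (equiv_valid R).
move=> y /[!inE] /andP[/and3P[v al sy] /and3P[ow nP nC]].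
by exists y; rewrite inE ow al sy nP nC v; split=> //; apply: connect0.
Qed.

Lemma nclasses_one_way : nclasses requiv (four S) =
  \sum_(x in X) (valid A B (set_edge e (pred1 true) x) +
                 [&& ~~ P x, ~~ C x & valid A B x]).
Proof.
rewrite big_split /= -nclasses_forward -nclasses_backward.
apply: (nclasses_split (rev_equiv_equivalence A B a b)).
- by apply/subsetP => x; rewrite inE => /andP[].
- by apply/subsetP => x; rewrite inE => /andP[].
- move=> x xS; have [xt|nxt] := boolP (one_way e true x).
    by exists x; [rewrite in_setU inE xS xt | apply: connect0].
  have ow : one_way e false x.
    have := one_way_solid e x; move: xS; rewrite inE => /and3P[_ _ /eqP ->].
    by rewrite (negPf eS) (negPf nxt) /= => /esym/negbFE.
  have flip : (exists2 y, one_way e true y & requiv x y) ->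
      exists2 y, y \in [set phi in four S | one_way e true phi] :|:
        [set phi in four S | [&& one_way e false phi, ~~ P phi & ~~ C phi]] & requiv x y.
    case=> y yt R; exists y => //.
    by rewrite in_setU inE yt (four_closed R xS).
  have [/andP[aT /(flip_cycle ow)[y yt R]]|nP] := boolP (P x).
    by apply: flip; exists y => //; apply: cyc_rel_equiv.
  have [/andP[bT /(flip_cut ow)[y [W [yt pot _ _]]]]|nC] := boolP (C x).
    by apply: flip; exists y => //; apply: coc_rel_equiv => //; eexists; apply: pot.
  by exists x; [rewrite in_setU !inE in xS *; rewrite xS ow nP nC orbT | apply: connect0].
move=> x y; rewrite !inE => /andP[_ xt] /andP[_ /and3P[yf nP nC]].
apply/negP; rewrite rev_equiv_sym => /(equiv_one_way yf nP nC).
by rewrite /one_way (one_way_in _ xt).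
Qed.

Lemma nclasses_delete :
  nclasses requiv [set phi in four (e |: S) | (e, true) \notin phi] =
  \sum_(x in X) (~~ C x && valid A B (set_edge e pred0 x)).
Proof.
apply: (nclasses_transversal (rev_equiv_equivalence A B a b) (f := set_edge e pred0)
  (p := fun x => ~~ C x && valid A B (set_edge e pred0 x)) tX).
- move=> x /[!inE] /and3P[ow al /eqP sx] /andP[nC v].
  by rewrite v allowed_delete // solid_set_edge sx /= !eqxx.
- move=> x y /[!inE] /andP[owx _] /andP[owy _] /andP[nCx _] /andP[nCy _].
  exact: equiv_delete_inj.
- move=> x y xb yb R; rewrite (on_cut_backward xb yb R).
  move: xb yb => /[!inE] /andP[owx _] /andP[owy _].
  have R' := equiv_set_edge pred0 owx owy R.
  by rewrite (equiv_valid R').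
move=> y /[!inE] /andP[/and3P[v al /eqP sy] yt].
have yf : (e, false) \notin y.
  by have := setU11 e S; rewrite -sy in_solid (negPf yt) => /eqP <-.
have nz : ~~ (b && zero_way_cocycle A B y) by case/andP: al.
have [x [owx nC R]] := exists_not_on_cut a yt yf nz.
exists x; rewrite inE owx -(equiv_valid R) v nC; split=> //=.
have deg := equiv_same_degree R; rewrite (same_degree_allowed _ _ _ _ deg) in al.
rewrite (allowed_one_way owx _ al) ?eqxx //=; apply/eqP.
by apply: (solid_one_way (s := pred0) owx _ _ eS) => //; rewrite -(same_degree_solid deg) sy.
Qed.

Lemma nclasses_contract :
  nclasses requiv [set phi in four (e |: S) | (e, true) \in phi] =
  \sum_(x in X) (~~ P x && valid A B (set_edge e predT x)).
Proof.
apply: (nclasses_transversal (rev_equiv_equivalence A B a b) (f := set_edge e predT)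
  (p := fun x => ~~ P x && valid A B (set_edge e predT x)) tX).
- move=> x /[!inE] /and3P[ow al /eqP sx] /andP[nP v].
  by rewrite v allowed_contract // solid_set_edge sx /= !eqxx.
- move=> x y /[!inE] /andP[owx _] /andP[owy _] /andP[nPx _] /andP[nPy _].
  exact: equiv_contract_inj.
- move=> x y xb yb R; rewrite (on_cycle_backward xb yb R).
  move: xb yb => /[!inE] /andP[owx _] /andP[owy _].
  have R' := equiv_set_edge predT owx owy R.
  by rewrite (equiv_valid R').
move=> y /[!inE] /andP[/and3P[v al /eqP sy] yt].
have yf : (e, false) \in y.
  by have := setU11 e S; rewrite -sy in_solid yt => /eqP <-.
have nt : ~~ (a && two_way_cycle y) by case/andP: al.
have [x [owx nP R]] := exists_not_on_cycle A B b yt yf nt.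
exists x; rewrite inE owx -(equiv_valid R) v nP; split=> //=.
have deg := equiv_same_degree R; rewrite (same_degree_allowed _ _ _ _ deg) in al.
rewrite (allowed_one_way owx _ al) //=; apply/eqP.
by apply: (solid_one_way (s := predT) owx _ _ eS) => //; rewrite -(same_degree_solid deg) sy.
Qed.

(** As [e] is solid, the presence of [(e, true)] tells 2-way from 0-way, a distinction preserved by
    equivalence. *)
Lemma nclasses_solid : nclasses requiv (four (e |: S)) =
  \sum_(x in X) ((~~ C x && valid A B (set_edge e pred0 x)) +
                 (~~ P x && valid A B (set_edge e predT x))).
Proof.
rewrite big_split /= -nclasses_delete -nclasses_contract.
apply: (nclasses_split (rev_equiv_equivalence A B a b)).
- by apply/subsetP => x; rewrite inE => /andP[].
- by apply/subsetP => x; rewrite inE => /andP[].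
- move=> x xS; exists x; last exact: connect0.
  by rewrite !(inE, in_setU) in xS *; rewrite xS; case: (_ \in x).
move=> x y; rewrite !inE => /andP[/and3P[_ _ /eqP sx] xt] /andP[/and3P[_ _ /eqP sy] yt].
apply/negP => /equiv_same_degree/(_ e).
have := setU11 e S; rewrite -{1}sx in_solid (negPf xt) => /eqP <-.
by have := setU11 e S; rewrite -{1}sy in_solid yt => /eqP <-.
Qed.

Lemma nclasses_four_setU1 : nclasses requiv (four (e |: S)) = nclasses requiv (four S).
Proof.
rewrite nclasses_solid nclasses_one_way; apply: eq_bigr => x xX.
have [/subsetP/(_ x xX) + _ _] := tX; rewrite inE => /andP[ow _].
by rewrite -valid_states.
Qed.

End OneEdge.

Lemma nclasses_four S T : nclasses requiv (four S) = nclasses requiv (four T).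
Proof.
suff empty U : nclasses requiv (four U) = nclasses requiv (four set0) by rewrite !empty.
move: {2}_.+1 (ltnSn #|U|) => n; elim: n U => // n IHn U; rewrite ltnS => leU.
have [->//|/set0Pn[e eU]] := eqVneq U set0.
rewrite -(setD1K eU); have [X tX] := transversal_exists
  (rev_equiv_equivalence A B a b) (backward (U :\ e) e).
rewrite (nclasses_four_setU1 _ tX) ?setD11 // IHn //.
by rewrite (cardsD1 e U) eU in leU.
Qed.

End Counting.

Theorem theorem4p5 (G : graph) (A B : {set vertex G * vertex G}) :
  (forall S T : {set edge G}, #|Four_cyc A B S| = #|Four_cyc A B T|) /\
  (forall S T : {set edge G}, #|Four_coc A B S| = #|Four_coc A B T|) /\
  (forall S T : {set edge G}, #|Four_cc A B S| = #|Four_cc A B T|).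
Proof.
have card a b S : #|equivalence_partition (rev_equiv A B a b) [set: fourientation G]
    ::&: four A B a b S| = nclasses (rev_equiv A B a b) (four A B a b S).
  apply: card_equivalence_partition; first exact: rev_equiv_equivalence.
  by move=> x y; apply: four_closed.
have part R R' D D' : R =2 R' -> D = D' ->
    #|equivalence_partition R [set: fourientation G] ::&: D| =
    #|equivalence_partition R' [set: fourientation G] ::&: D'|.
  move=> RR ->; congr #|pred_of_set (_ ::&: _)|; apply: eq_imset => x.
  by apply/setP => y; rewrite !inE RR.
split; [|split] => S T.
- have E U : #|Four_cyc A B U| = nclasses (rev_equiv A B true false) (four A B true false U).
    rewrite -card; apply: part.
      by apply: eq_connect => x y; rewrite /step /= orbF.
    by apply/setP => x; rewrite !inE /allowed /= andbT.
  by rewrite !E; apply: nclasses_four.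
- have E U : #|Four_coc A B U| = nclasses (rev_equiv A B false true) (four A B false true U).
    rewrite -card; apply: part; first by apply: eq_connect.
    by apply/setP => x; rewrite !inE.
  by rewrite !E; apply: nclasses_four.
have E U : #|Four_cc A B U| = nclasses (rev_equiv A B true true) (four A B true true U).
  rewrite -card; apply: part; first by apply: eq_connect.
  by apply/setP => x; rewrite !inE /allowed /= !andbA.
by rewrite !E; apply: nclasses_four.
Qed.
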